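(* For $i=1,2$ let $(Y^i,M^i,R^i)$ be a solution of the doubly reflected BSDE with data $(\xi^i,f^i+dV^i,L^i,U^i)$ on $[0,T]$. Assume that: (1) for a.e. $t\in[0,T]$ the function $y\mapsto f^1(t,y)$ is nonincreasing; (2) $\xi^1\le\xi^2$; (3) $f^1(t,Y^2_t)\le f^2(t,Y^2_t)$ $dt\otimes dP$-a.s.; (4) $dV^1\le dV^2$ (i.e. $V^2-V^1$ is increasing); (5) $L^1\le L^2$ and $U^1\le U^2$. If $(Y^1-Y^2)^+$ is of class (D), then $Y^1\le Y^2$.
   Context: Setting. $(\Omega,\mathcal F,P)$ is a probability space with a filtration $\mathbb F=(\mathcal F_t)_{t\ge 0}$ satisfying the usual conditions (otherwise arbitrary), and $T$ is an arbitrary, possibly infinite, $\mathbb F$-stopping time. Put $T_a=T\wedge a$. Relations between random variables hold $P$-a.s. $\mathcal T$ is the set of $\mathbb F$-stopping times with values in $[0,T]$. A progressively measurable process $X$ is of class (D) if $\{X_\tau:\tau\in\mathcal T,\tau<\infty\}$ is uniformly integrable; if $X_\infty$ is not defined, set $X_\infty=0$. For processes, $X\le Y$ means $X_t\le Y_t$ for $t\in[0,T_a]$, $a\ge0$. A process is regulated if its paths have a right limit $y_{t+}$ and a left limit $y_{t-}$ at every point; $\Delta^+y_t=y_{t+}-y_t$. $\mathcal M_{loc}$ is the set of local $\mathbb F$-martingales $M$ with $M_0=0$; $\mathcal V$ is the set of progressively measurable finite variation processes $V$ with $V_0=0$; $\mathcal V_p$ is the set of predictable elements of $\mathcal V$.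 For $V\in\mathcal V$: $V^d_t=\sum_{s<t}\Delta^+V_s$, $V^*=V-V^d$ (the càdlàg part), and $\int_t^s dV_r=V_s-V_t$. For a process $X$, $\overrightarrow X_s=\limsup_{r\uparrow s}X_r$ and $\underrightarrow X_s=\liminf_{r\uparrow s}X_r$. Data. A generator $f:\Omega\times[0,T]\times\mathbb R\to\mathbb R$ is progressively measurable for each fixed $y$; $\xi$ is $\mathcal F_T$-measurable; $V\in\mathcal V$; $L,U$ are optional processes of class (D) with $\limsup_{a\to\infty}L_{T_a}\le\xi\le\liminf_{a\to\infty}U_{T_a}$. A triple $(Y,M,R)$ of $\mathbb F$-adapted processes is a solution of the doubly reflected BSDE with data $(\xi,f+dV,L,U)$ on $[0,T]$ if: (a) $Y$ is regulated and $M\in\mathcal M_{loc}$; (b) $R\in\mathcal V_p$, $L_t\le Y_t\le U_t$ for $t\in[0,T_a]$, $a\ge0$, and for every $a\ge 0$ $$\int_0^{T_a}(Y_{r-}-\overrightarrow L_r)\,dR^{*,+}_r+\sum_{0\le r<T_a}(Y_r-L_r)\Delta^+R^+_r+\int_0^{T_a}(\underrightarrow U_r-Y_{r-})\,dR^{*,-}_r+\sum_{0\le r<T_a}(U_r-Y_r)\Delta^+R^-_r=0,$$ where $R=R^+-R^-$ is the Jordan decomposition and $R^{*,\pm}$ is the càdlàg part of $R^\pm$; (c) $\int_0^{T_a}|f(r,Y_r)|\,dr<\infty$ for every $a\ge0$; (d) for every $a\ge0$ and $t\in[0,T_a]$, $Y_t=Y_{T_a}+\int_t^{T_a}f(r,Y_r)\,dr+\int_t^{T_a}dV_r+\int_t^{T_a}dR_r-\int_t^{T_a}dM_r$;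 (e) $\lim_{a\to\infty}Y_{T_a}=\xi$ a.s. *)

(* Defs.v *)
From HB Require Import structures.
From mathcomp Require Import all_boot all_order all_algebra.
From mathcomp Require Import all_classical all_reals all_analysis.

Set Implicit Arguments.
Unset Strict Implicit.
Unset Printing Implicit Defensive.

Import Order.TTheory GRing.Theory Num.Theory.
Import numFieldNormedType.Exports.

Local Open Scope classical_set_scope.
Local Open Scope ring_scope.

(* Time is a real number [t]; only [0 <= t] is meaningful, and every definition
   below constrains paths and processes on [0, +oo[ only.  A process is a map
   [X : R -> Omega -> R], time first. *)

Section paths.
Context {R : realType}.
Implicit Types y k l u : R -> R.

Definition rlim y (t : R) : R := lim (y r @[r --> t^'+]).
Definition llim y (t : R) : R := lim (y r @[r --> t^'-]).
Definition rjump y (t : R) : R := rlim y t - y t.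

Definition regulated y :=
  (forall t : R, 0 <= t -> cvg (y r @[r --> t^'+])) /\
  (forall t : R, 0 < t -> cvg (y r @[r --> t^'-])).

Definition cadlag y :=
  (forall t : R, 0 <= t -> y r @[r --> t^'+] --> y t) /\
  (forall t : R, 0 < t -> cvg (y r @[r --> t^'-])).

Definition finite_variation y :=
  forall t : R, 0 <= t -> bounded_variation 0 t y.

Definition left_limsup y (t : R) : \bar R := limf_esup (EFin \o y) (t^'-).
Definition left_liminf y (t : R) : \bar R := limf_einf (EFin \o y) (t^'-).

(* Jordan decomposition k = k^+ - k^- on [0, +oo[ of a path of finite variation
   with k 0 = 0: since [pos_tv 0 k t = (TV 0 t k + k t) / 2] and
   [neg_tv 0 k t = (TV 0 t k - k t) / 2], these are the positive and the
   negative variation of k on [0, t]. *)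
Definition jordan_pos_part k (t : R) : R := fine (pos_tv 0 k t).
Definition jordan_neg_part k (t : R) : R := fine (neg_tv 0 k t).

(* [cadlag_part y t = y t - \sum_(0 <= s < t) (y s+ - y s)].  It is only applied
   to nondecreasing y, whose jumps are nonnegative as [\esum] requires. *)
Definition cadlag_part y (t : R) : R :=
  y t - fine (\esum_(s in `[0%R, t[) (rjump y s)%:E)%E.

(* The minimality condition on [0, b] for the path y, the reflecting path k and
   the barriers l <= y <= u.  The integrals are over ]0, b].  The bundled
   [Ap] and [Am] are the extensions to R of the càdlàg nondecreasing functions
   k^{*,+} and k^{*,-}; their values at negative times do not matter.
   The integrands are in [0, +oo], as left_limsup l may be -oo and
   left_liminf u may be +oo. *)
Definition minimality y k l u (b : R) : Prop :=
  let kp := jordan_pos_part k in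
  let km := jordan_neg_part k in
  exists Ap Am : cumulative R R,
    [/\ forall t : R, 0 <= t -> Ap t = cadlag_part kp t,
        forall t : R, 0 <= t -> Am t = cadlag_part km t &
        (\int[lebesgue_stieltjes_measure Ap]_(r in `]0%R, b])
            ((llim y r)%:E - left_limsup l r)
         + \esum_(r in `[0%R, b[) ((y r - l r) * rjump kp r)%:E
         + \int[lebesgue_stieltjes_measure Am]_(r in `]0%R, b])
            (left_liminf u r - (llim y r)%:E)
         + \esum_(r in `[0%R, b[) ((u r - y r) * rjump km r)%:E = 0)%E].

End paths.

Section stochastic_basis.
Context {R : realType} {d : measure_display} {Omega : measurableType d}.
Variable P : probability Omega R.
Variable F : R -> set (set Omega).

Definition filtration :=
  [/\ forall t : R, 0 <= t -> sigma_algebra setT (F t),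
      forall t : R, 0 <= t -> F t `<=` measurable &
      forall s t : R, 0 <= s -> s <= t -> F s `<=` F t].

Definition usual_conditions :=
  (forall N, P.-negligible N -> F 0 N) /\
  (forall t : R, 0 <= t -> \bigcap_(s in `]t, +oo[) F s `<=` F t).

Definition measurable_wrt (G : set (set Omega)) (X : Omega -> R) :=
  measurable_fun setT (X : g_sigma_algebraType G -> R).

Definition stopping_time (tau : Omega -> \bar R) :=
  (forall w, (0 <= tau w)%E) /\
  (forall t : R, 0 <= t -> F t [set w | (tau w <= t%:E)%E]).

(* [tmin tau a] is the real-valued random time tau /\ a. *)
Definition tmin (tau : Omega -> \bar R) (a : R) (w : Omega) : R :=
  fine (Order.min (tau w) a%:E).

Definition sigma_at (tau : Omega -> \bar R) : set (set Omega) :=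
  [set A | measurable A /\
     forall t : R, 0 <= t -> F t (A `&` [set w | (tau w <= t%:E)%E])].

Definition adapted (X : R -> Omega -> R) :=
  forall t : R, 0 <= t -> measurable_wrt (F t) (X t).

Definition progressive (X : R -> Omega -> R) :=
  forall t : R, 0 <= t ->
    measurable_fun (`[0, t] `*` [set: g_sigma_algebraType (F t)])
      (fun z : R * g_sigma_algebraType (F t) => X z.1 z.2).

Definition half_line : set (R * Omega) := [set z | 0 <= z.1].

Definition predictable_rectangles : set (set (R * Omega)) :=
  [set B | (exists2 A, F 0 A & B = [set 0] `*` A) \/
     (exists (s t : R) (A : set Omega), [/\ 0 <= s, s < t, F s A & B = `]s, t] `*` A])].

Definition predictable (X : R -> Omega -> R) :=
  measurable_fun half_line
    (fun z : g_sigma_algebraType predictable_rectangles => X z.1 z.2).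

Definition optional_generators : set (set (R * Omega)) :=
  [set B | exists X A,
     [/\ adapted X, forall w, cadlag (X ^~ w), measurable A &
         B = half_line `&` [set z | A (X z.1 z.2)]]].

Definition optional (X : R -> Omega -> R) :=
  measurable_fun half_line
    (fun z : g_sigma_algebraType optional_generators => X z.1 z.2).

Definition uniformly_integrable (S : set (Omega -> R)) :=
  (forall X, S X -> measurable_fun setT X) /\
  (forall e : R, 0 < e -> exists c : R, forall X, S X ->
     (\int[P]_(w in [set w | (c < `|X w|)%R]) `|X w|%:E <= e%:E)%E).

(* X_tau, with X_oo = 0. *)
Definition value_at (X : R -> Omega -> R) (tau : Omega -> \bar R) (w : Omega)
    : R :=
  if tau w is r%:E then X r w else 0.

(* Progressive measurability of X is not part of the definition; the X_tau are
   required to be measurable by [uniformly_integrable]. *)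
Definition class_D (T : Omega -> \bar R) (X : R -> Omega -> R) :=
  uniformly_integrable
    [set Z | exists tau, [/\ stopping_time tau, forall w, (tau w <= T w)%E,
       \forall w \ae P, (tau w < +oo)%E & Z = value_at X tau]].

Definition is_cond_exp (G : set (set Omega)) (X Z : Omega -> R) :=
  [/\ measurable_wrt G Z, P.-integrable setT (EFin \o Z) &
      forall A, G A -> (\int[P]_(w in A) (Z w)%:E = \int[P]_(w in A) (X w)%:E)%E].

Definition martingale (M : R -> Omega -> R) :=
  [/\ adapted M, forall t : R, 0 <= t -> P.-integrable setT (EFin \o M t) &
      forall s t : R, 0 <= s -> s <= t -> is_cond_exp (F s) (M t) (M s)].

(* Local martingales null at 0; as usual they have càdlàg paths. *)
Definition local_martingale0 (M : R -> Omega -> R) :=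
  [/\ adapted M, \forall w \ae P, cadlag (M ^~ w),
      \forall w \ae P, M 0 w = 0 &
      exists tau : nat -> Omega -> \bar R,
        [/\ forall n, stopping_time (tau n),
            \forall w \ae P, nondecreasing_seq (tau ^~ w),
            \forall w \ae P, tau n w @[n --> \oo] --> +oo%E &
            forall n, martingale (fun t w => M (tmin (tau n) t w) w)]].

Definition fv_process (V : R -> Omega -> R) :=
  [/\ progressive V, \forall w \ae P, finite_variation (V ^~ w) &
      \forall w \ae P, V 0 w = 0].

Definition fv_predictable (V : R -> Omega -> R) :=
  fv_process V /\ predictable V.

Definition process_le (T : Omega -> \bar R) (X Y : R -> Omega -> R) :=
  \forall w \ae P, forall a : R, 0 <= a ->
    forall t : R, t \in `[0%R, tmin T a w] -> X t w <= Y t w.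

(* The inequality dV <= dW between finite variation processes on [0, T]. *)
Definition dprocess_le (T : Omega -> \bar R) (V W : R -> Omega -> R) :=
  \forall w \ae P, forall s t : R, 0 <= s -> s <= t -> (t%:E <= T w)%E ->
    W s w - V s w <= W t w - V t w.

(* Standing assumptions on the data (xi, f + dV, L, U); f takes time, then the
   random element, then the space variable. *)
Record drbsde_data (T : Omega -> \bar R) (xi : Omega -> R)
    (f : R -> Omega -> R -> R) (V L U : R -> Omega -> R) : Prop := {
  data_generator : forall y, progressive (fun t w => f t w y) ;
  data_terminal : measurable_wrt (sigma_at T) xi ;
  data_fv : fv_process V ;
  data_lower_optional : optional L ;
  data_upper_optional : optional U ;
  data_lower_class_D : class_D T L ;
  data_upper_class_D : class_D T U ;
  data_lower_terminal : \forall w \ae P,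
    (limf_esup (fun a : R => (L (tmin T a w) w)%:E) (pinfty_nbhs R)
       <= (xi w)%:E)%E ;
  data_upper_terminal : \forall w \ae P,
    ((xi w)%:E
       <= limf_einf (fun a : R => (U (tmin T a w) w)%:E) (pinfty_nbhs R))%E
}.

(* (Y, M, K) solves the doubly reflected BSDE with data (xi, f + dV, L, U) on
   [0, T]; K is the reflecting process. *)
Record drbsde_solution (T : Omega -> \bar R) (xi : Omega -> R)
    (f : R -> Omega -> R -> R) (V L U : R -> Omega -> R)
    (Y M K : R -> Omega -> R) : Prop := {
  sol_adapted : [/\ adapted Y, adapted M & adapted K] ;
  sol_regulated : \forall w \ae P, regulated (Y ^~ w) ;
  sol_martingale : local_martingale0 M ;
  sol_reflection : fv_predictable K ;
  sol_above_lower : process_le T L Y ;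
  sol_below_upper : process_le T Y U ;
  sol_minimality : \forall w \ae P, forall a : R, 0 <= a ->
    minimality (Y ^~ w) (K ^~ w) (L ^~ w) (U ^~ w) (tmin T a w) ;
  sol_integrable : \forall w \ae P, forall a : R, 0 <= a ->
    (@lebesgue_measure R).-integrable `[0%R, tmin T a w]
      (fun r => (f r w (Y r w))%:E) ;
  sol_equation : \forall w \ae P, forall a : R, 0 <= a ->
    forall t : R, t \in `[0%R, tmin T a w] ->
    Y t w = Y (tmin T a w) w
      + \int[@lebesgue_measure R]_(r in `[t, tmin T a w]) f r w (Y r w)
      + (V (tmin T a w) w - V t w)
      + (K (tmin T a w) w - K t w)
      - (M (tmin T a w) w - M t w) ;
  sol_terminal : \forall w \ae P,
    Y (tmin T a w) w @[a --> +oo] --> xi w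
}.

End stochastic_basis.

(* Main.v *)
Require Import Defs.
From HB Require Import structures.
From mathcomp Require Import all_boot all_order all_algebra.
From mathcomp Require Import all_classical all_reals all_analysis.
From mathcomp Require Import measurable_realfun.
From mathcomp Require Import lra.

Set Implicit Arguments.
Unset Strict Implicit.
Unset Printing Implicit Defensive.

Import Order.TTheory GRing.Theory Num.Theory.
Import numFieldNormedType.Exports.

Local Open Scope classical_set_scope.
Local Open Scope ring_scope.

(** Write Y = Y1 - Y2 and M = M1 - M2.  As long as Y > 0, every finite variation
part of the equation drives Y upwards in time: f1 (Y1) <= f1 (Y2) <= f2 (Y2) by
monotonicity, dV1 <= dV2, the process K1 cannot increase since
Y1 > Y2 >= L2 >= L1, and K2 cannot decrease since Y2 < Y1 <= U1 <= U2.  So Y is a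
local submartingale on each of its positive excursions, which can be exploited by
stopping Y before it reaches zero, without expanding its positive part.

Fix t and eps > 0 and let rho be the first rational time after t at which
Y < eps.  On [t, rho] the left limits of Y are at least eps, so the left limits
in the minimality condition make the càdlàg parts of the positive part of K1 and
of the negative part of K2 constant there, and the values in it remove their
right jumps wherever Y > 0.  Times at which Y <= 0 may remain, but immediately
after them Y is close to or above eps, hence its drift jumps upwards.
Altogether Y - M does not decrease on [t, rho] ([drift_nondecreasing_until]).
At rho itself Y <= eps, because a positive value of Y cannot be followed by a
downward right jump ([right_jump_ge], [le_of_rational_hits]).

Optional stopping of the localized martingales at rho, cut off by the localizing
times, T and n, then bounds the integral of Y t over {Y t > 0, t < T} by that of
the positive part of Y at the cut-off time ([optional_stopping_le],
[stopping_inequality]).  As n grows, the positive part of Y there is eventually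
at most eps: either rho < T, or the terminal condition xi1 <= xi2 applies.  Class
(D) lets the limit pass under the integral ([uniformly_dominated_cvg0]), so the
integral is at most 2 eps for every eps, and Y t <= 0 almost surely on {t < T}.
Applied to all rational t, this extends to every time before T, once more
because positive values of Y are not followed by downward right jumps, and to T
by the terminal condition. *)

(** * Where a minimal reflecting process is flat *)

Section reflection.
Context {R : realType}.
Implicit Types (k h l u y : R -> R) (g : R -> \bar R) (b r s t : R).

Import HBNNSimple.

(** The integrand f, a left upper limit in the application, may fail to be
measurable.  The integral of a nonnegative function is a supremum over simple
functions below it, and eta times the indicator of E is one of them. *)
Lemma integral_eq0_measure0 d (T : measurableType d)
    (mu : {measure set T -> \bar R}) (D E : set T) (f : T -> \bar R) (eta : R) :
  measurable E -> E `<=` D -> 0 < eta ->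
  (forall x, D x -> 0 <= f x)%E -> (forall x, E x -> eta%:E <= f x)%E ->
  (\int[mu]_(x in D) f x = 0)%E -> mu E = 0%E.
Proof.
move=> mE ED eta0 f0 fE intf0; apply/eqP; rewrite eq_le measure_ge0 andbT.
suff : (eta%:E * mu E <= 0)%E by rewrite pmule_rle0// lte_fin.
rewrite -intf0 integral_mkcond ge0_integralTE; last exact: erestrict_ge0.
apply: ereal_sup_ubound => /=.
exists (scale_nnsfun (indic_nnsfun R mE) (ltW eta0)); last first.
  rewrite (eq_sintegral (cst eta \* indic_nnsfun R mE)) ?sintegralrM//.
  by rewrite (eq_sintegral \1_E) ?sintegral_indic.
move=> x /=; rewrite measurable_realfun.mindicE patchE.
have [xE|xE] := boolP (x \in E).
  by move/set_mem in xE; rewrite mulr1 ifT ?fE// inE; exact: ED.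
rewrite mulr0; case: ifPn => // xD; apply: f0; exact/set_mem.
Qed.

Lemma lebesgue_stieltjes_measure_oc (A : cumulative R R) (u v : R) : u <= v ->
  lebesgue_stieltjes_measure A `]u, v] = (A v - A u)%:E.
Proof.
move=> uv; rewrite /lebesgue_stieltjes_measure /measure_extension.
by rewrite measurable_mu_extE/= ?wlength_itv_bnd//; exact: is_ocitv.
Qed.

Definition nondecreasing_halfline (k : R -> R) :=
  forall s t : R, 0 <= s -> s <= t -> k s <= k t.

Lemma nondecreasing_halfline_cvg_right k r : nondecreasing_halfline k ->
  0 <= r -> cvg (k s @[s --> r^'+]).
Proof.
move=> ndk r0; apply: nondecreasing_at_right_is_cvgr.
- near=> x => s t; rewrite !in_itv/= => /andP[rs _] _ st.
  by apply: ndk => //; exact: (le_trans r0 (ltW rs)).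
- near=> x; exists (k r) => _ /= [s + <-]; rewrite in_itv/= => /andP[rs _].
  by apply: ndk => //; exact: ltW.
Unshelve. all: by end_near. Qed.

Lemma rjump_ge0 k r : nondecreasing_halfline k -> 0 <= r -> 0 <= rjump k r.
Proof.
move=> ndk r0; rewrite /rjump subr_ge0 /rlim; apply: limr_ge.
  exact: nondecreasing_halfline_cvg_right.
near=> s; apply: ndk => //; near: s; exact: nbhs_right_ge.
Unshelve. all: by end_near. Qed.

Lemma jordan_pos_part_nondecreasing k :
  finite_variation k -> nondecreasing_halfline (jordan_pos_part k).
Proof.
move=> fvk s t s0 st.
have BV : bounded_variation 0 t (\- k).
  by apply/bounded_variationN/fvk/(le_trans s0).
have nd := fine_neg_tv_nondecreasing BV.
by apply: nd; rewrite ?in_itv/= ?lexx ?s0 ?st ?(le_trans s0 st).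
Qed.

Lemma jordan_neg_part_nondecreasing k :
  finite_variation k -> nondecreasing_halfline (jordan_neg_part k).
Proof.
move=> fvk s t s0 st.
have BV : bounded_variation 0 t k by exact/fvk/(le_trans s0).
have nd := fine_neg_tv_nondecreasing BV.
by apply: nd; rewrite ?in_itv/= ?lexx ?s0 ?st ?(le_trans s0 st).
Qed.

Lemma jordanE k t : finite_variation k -> 0 <= t ->
  k t = jordan_pos_part k t - jordan_neg_part k t.
Proof.
move=> fvk t0; have := bounded_variation_pos_neg_tvE (fvk _ t0).
by apply; rewrite in_itv/= t0 lexx.
Qed.

(** One half of the minimality condition, for a Jordan part k of the reflecting
process: g is the distance of the solution to the barrier measured with left
limits, which the càdlàg part of k sees, and h is the distance at the time
itself, which the right jumps of k see. *)
Definition acts_only k g h b :=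
  [/\ nondecreasing_halfline k,
     forall r, 0 < r -> r <= b -> (0 <= g r)%E,
     exists2 A : cumulative R R, forall t : R, 0 <= t -> A t = cadlag_part k t &
       (\int[lebesgue_stieltjes_measure A]_(r in `]0%R, b]) g r = 0)%E &
     forall r, 0 <= r -> r < b -> h r * rjump k r = 0].

(** An increment of k is the mass of its càdlàg part plus its right jumps.  The
mass vanishes on ]u, v] because the integral of g is zero while g >= eta there;
the right jumps on [u, v[ vanish because h does not. *)
Lemma acts_only_constant k g h b (u v eta : R) : acts_only k g h b ->
  0 <= u -> u <= v -> v <= b -> 0 < eta ->
  (forall r, u < r -> r <= v -> (eta%:E <= g r)%E) ->
  (forall r, u <= r -> r < v -> h r != 0) -> k u = k v.
Proof.
move=> [ndk g0 [A Ak intg] hk] u0 uv vb eta0 geta hn0.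
have : lebesgue_stieltjes_measure A `]u, v] = 0%E.
  pose mu : {measure set (measurableTypeR R) -> \bar R} :=
    lebesgue_stieltjes_measure A.
  apply: (@integral_eq0_measure0 _ (measurableTypeR R) mu
    `]0, b]%classic `]u, v]%classic g eta) => //.
  - by move=> r; rewrite /= !in_itv/= => /andP[ur rv];
      rewrite (le_lt_trans u0 ur) (le_trans rv vb).
  - by move=> r; rewrite /= in_itv/= => /andP[]; exact: g0.
  - by move=> r; rewrite /= in_itv/= => /andP[]; exact: geta.
rewrite lebesgue_stieltjes_measure_oc// => -[/eqP]; rewrite subr_eq0 => /eqP.
have v0 : 0 <= v by exact: le_trans uv.
rewrite !Ak// /cadlag_part.
suff -> : (\esum_(s in `[0%R, v[) (rjump k s)%:E =
           \esum_(s in `[0%R, u[) (rjump k s)%:E)%E by move=> /addIr.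
rewrite esum_mkcond [RHS]esum_mkcond; apply: eq_esum => s _; rewrite !mem_setE.
rewrite !in_itv/=; have [s0/=|//] := leP 0 s.
have [su|us] := ltP s u; first by rewrite (lt_le_trans su uv).
have [sv|//] := ltP s v.
have := hk _ s0 (lt_le_trans sv vb) => /eqP; rewrite mulf_eq0 => /orP[|/eqP ->//].
by rewrite (negbTE (hn0 _ us sv)).
Qed.

(** This covers a single time at which only h is known to be nonzero, where
[acts_only_constant] says nothing. *)
Lemma acts_only_cvg_right k g h b r : acts_only k g h b ->
  0 <= r -> r < b -> h r != 0 -> k s @[s --> r^'+] --> k r.
Proof.
move=> [ndk _ _ hk] r0 rb hr.
have /eqP := hk _ r0 rb; rewrite mulf_eq0 (negbTE hr)/= subr_eq0 => /eqP <-.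
exact: nondecreasing_halfline_cvg_right.
Qed.

Lemma left_limsup_le l r s (c : R) : s < r ->
  (forall x, s < x -> x < r -> l x <= c) -> (left_limsup l r <= c%:E)%E.
Proof.
move=> sr lc; rewrite /left_limsup limf_esupE; apply: ge_ereal_inf.
exists (ereal_sup ((EFin \o l) @` `]s, r[)).
  exists `]s, r[%classic => //; near=> x; rewrite /= in_itv/=; apply/andP; split.
    by near: x; exact: nbhs_left_gt.
  by near: x; exact: nbhs_left_lt.
apply: ge_ereal_sup => _ /= [x + <-]; rewrite in_itv/= => /andP[sx xr].
by rewrite lee_fin lc.
Unshelve. all: by end_near. Qed.

Lemma llim_sub_left_limsup_ge y l r s (eta : R) : s < r ->
  cvg (y x @[x --> r^'-]) ->
  (forall x, s < x -> x < r -> l x + eta <= y x) ->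
  (eta%:E <= (llim y r)%:E - left_limsup l r)%E.
Proof.
move=> sr cy ly.
suff : (left_limsup l r <= (llim y r - eta)%:E)%E.
  case: (left_limsup l r) => [x| |]//=.
    by rewrite -EFinD !lee_fin => ?; lra.
  by rewrite addey// leey.
apply/lee_addgt0Pr => e e0.
have [d /= d0 dy] := (cvgrPdist_lt _ _).1 cy _ e0.
rewrite -EFinD.
apply: (@left_limsup_le _ _ (Num.max s (r - d)) _).
  by rewrite gt_max sr/= ltrBlDr ltrDl.
move=> x; rewrite gt_max => /andP[sx dx] xr.
have := dy x ltac:(by rewrite /= gtr0_norm; lra) xr.
rewrite ltr_norml -/(llim y r) => /andP[d1 d2].
have lyx := ly _ sx xr; lra.
Qed.

Lemma left_liminf_sub_llim_ge y u r s (eta : R) : s < r ->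
  cvg (y x @[x --> r^'-]) ->
  (forall x, s < x -> x < r -> y x + eta <= u x) ->
  (eta%:E <= left_liminf u r - (llim y r)%:E)%E.
Proof.
move=> sr cy yu.
have := @llim_sub_left_limsup_ge (\- y) (\- u) r s eta sr (is_cvgN cy).
have -> : llim (\- y) r = - llim y r by rewrite /llim limN.
rewrite /left_liminf /limf_einf EFinN addeC; apply => x sx xr /=.
by have /= := yu _ sx xr; lra.
Qed.

(** The four terms of the minimality condition are nonnegative and add up to
zero, so each of them is zero. *)
Lemma minimality_acts_only y k l u b : regulated y -> finite_variation k ->
  (forall t, 0 <= t -> t <= b -> l t <= y t <= u t) ->
  minimality y k l u b ->
  acts_only (jordan_pos_part k)
    (fun r => (llim y r)%:E - left_limsup l r)%E (fun r => y r - l r) b /\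
  acts_only (jordan_neg_part k)
    (fun r => left_liminf u r - (llim y r)%:E)%E (fun r => u r - y r) b.
Proof.
move=> [_ cly] fvk lyu [Ap [Am [ApE AmE]]].
have ndp := jordan_pos_part_nondecreasing fvk.
have ndm := jordan_neg_part_nondecreasing fvk.
set I1 := (X in (X + _ + _ + _)%E); set I2 := (X in (_ + X + _ + _)%E).
set I3 := (X in (_ + _ + X + _)%E); set I4 := (X in (_ + _ + _ + X)%E).
have g1 r : 0 < r -> r <= b -> (0 <= (llim y r)%:E - left_limsup l r)%E.
  move=> r0 rb; apply: (@llim_sub_left_limsup_ge _ _ _ 0) => //; first exact: cly.
  by move=> x x0 xr; rewrite addr0; have /andP[] := lyu x (ltW x0) ltac:(lra).
have g3 r : 0 < r -> r <= b -> (0 <= left_liminf u r - (llim y r)%:E)%E.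
  move=> r0 rb; apply: (@left_liminf_sub_llim_ge _ _ _ 0) => //; first exact: cly.
  by move=> x x0 xr; rewrite addr0; have /andP[] := lyu x (ltW x0) ltac:(lra).
have g2 r : `[0, b[%classic r ->
    (0 <= ((y r - l r) * rjump (jordan_pos_part k) r)%:E)%E.
  rewrite /= in_itv/= => /andP[r0 rb]; have /andP[? _] := lyu r r0 (ltW rb).
  by rewrite lee_fin mulr_ge0 ?rjump_ge0 ?subr_ge0.
have g4 r : `[0, b[%classic r ->
    (0 <= ((u r - y r) * rjump (jordan_neg_part k) r)%:E)%E.
  rewrite /= in_itv/= => /andP[r0 rb]; have /andP[_ ?] := lyu r r0 (ltW rb).
  by rewrite lee_fin mulr_ge0 ?rjump_ge0 ?subr_ge0.
have I10 : (0 <= I1)%E.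
  by apply: integral_ge0 => r; rewrite /= in_itv/= => /andP[]; exact: g1.
have I30 : (0 <= I3)%E.
  by apply: integral_ge0 => r; rewrite /= in_itv/= => /andP[]; exact: g3.
have I20 : (0 <= I2)%E by apply: esum_ge0.
have I40 : (0 <= I4)%E by apply: esum_ge0.
have I120 : (0 <= I1 + I2)%E by rewrite adde_ge0.
have I1230 : (0 <= I1 + I2 + I3)%E by rewrite adde_ge0.
move=> /eqP; rewrite padde_eq0// => /andP[+ /eqP e4].
rewrite padde_eq0// => /andP[+ /eqP e3].
rewrite padde_eq0// => /andP[/eqP e1 /eqP e2].
have esum0 (a : R -> R) r : (forall r, `[0, b[%classic r -> (0 <= (a r)%:E)%E) ->
    (\esum_(r in `[0%R, b[) (a r)%:E = 0)%E -> 0 <= r -> r < b -> a r = 0.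
  move=> a0 ea r0 rb; have rI : `[0, b[%classic r by rewrite /= in_itv/= r0.
  apply/eqP; rewrite eq_le -!lee_fin a0// andbT -[leRHS]ea.
  by apply: esum_ge; exists [set r]; rewrite ?fsbig_set1//; split => // ? ->.
split; split => //.
- by exists Ap.
- by move=> r r0 rb; exact: (esum0 (fun r => (y r - l r) * rjump _ r)).
- by exists Am.
- by move=> r r0 rb; exact: (esum0 (fun r => (u r - y r) * rjump _ r)).
Qed.

End reflection.

(** * Comparison along one pair of paths *)

Section rational_limits.
Context {R : realType}.
Implicit Types (y : R -> R) (r c : R).

Lemma near_right_ge_rational y r c (eps e : R) : r < c -> 0 < e ->
  cvg (y s @[s --> r^'+]) ->
  (forall q : rat, r < ratr q -> ratr q < c -> eps <= y (ratr q)) ->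
  \forall s \near r^'+, eps - e <= y s.
Proof.
move=> rc e0 cy yq; set l := lim _ in cy.
have e20 : 0 < e / 2 by lra.
have [d /= d0 dy] := (cvgrPdist_lt _ _).1 cy _ e20.
have [q] : exists q : rat, ratr q \in `]r, Num.min c (r + d)[.
  by apply: rat_in_itvoo; rewrite lt_min rc ltrDl.
rewrite in_itv/= lt_min => /andP[rq /andP[qc qd]].
have := dy (ratr q) ltac:(by rewrite /= ltr0_norm; lra) rq.
have := yq _ rq qc => yqe.
rewrite ltr_norml => /andP[q1 q2].
exists d => //= s /= sd rs; have := dy s sd rs.
by rewrite ltr_norml => /andP[s1 s2]; lra.
Qed.

Lemma near_left_ge_rational y r c (eps e : R) : c < r -> 0 < e ->
  cvg (y s @[s --> r^'-]) ->
  (forall q : rat, c < ratr q -> ratr q < r -> eps <= y (ratr q)) ->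
  \forall s \near r^'-, eps - e <= y s.
Proof.
move=> cr e0 cy yq; set l := lim _ in cy.
have e20 : 0 < e / 2 by lra.
have [d /= d0 dy] := (cvgrPdist_lt _ _).1 cy _ e20.
have [q] : exists q : rat, ratr q \in `]Num.max c (r - d), r[.
  by apply: rat_in_itvoo; rewrite gt_max cr/= ltrBlDr ltrDl.
rewrite in_itv/= gt_max => /andP[/andP[cq qd] rq].
have := dy (ratr q) ltac:(by rewrite /= gtr0_norm; lra) rq.
have := yq _ cq rq => yqe.
rewrite ltr_norml => /andP[q1 q2].
exists d => //= s /= sd rs; have := dy s sd rs.
by rewrite ltr_norml => /andP[s1 s2]; lra.
Qed.

End rational_limits.

Section comparison_of_paths.
Context {R : realType}.
Notation mu := (@lebesgue_measure R).
Implicit Types (r s t c eps eta e : R).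

(** A path of a solution on [0, b]: m is the path of the local martingale, and g
stands for the generator evaluated along y. *)
Record reflected_path (b : R) (y m k v g l u : R -> R) : Prop := {
  path_regulated : regulated y ;
  path_noise : forall t : R, 0 <= t -> m s @[s --> t^'+] --> m t ;
  path_reflection : finite_variation k ;
  path_barriers : forall t : R, 0 <= t -> t <= b -> l t <= y t <= u t ;
  path_minimality : minimality y k l u b ;
  path_integrable : mu.-integrable `[0, b] (EFin \o g) ;
  path_equation : forall t : R, 0 <= t -> t <= b ->
    y t = y b + \int[mu]_(r in `[t, b]) g r
      + (v b - v t) + (k b - k t) - (m b - m t) }.

Lemma path_increment b y m k v g l u s t :
  reflected_path b y m k v g l u -> 0 <= s -> s <= t -> t <= b ->
  (y t - m t) - (y s - m s) =
  - (\int[mu]_(r in `[s, t]) g r) - (v t - v s) - (k t - k s).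
Proof.
move=> P s0 st tb; have sb := le_trans st tb; have t0 := le_trans s0 st.
have := path_equation P s0 sb; have := path_equation P t0 tb.
have intg : mu.-integrable `[s, b] (EFin \o g).
  apply: integrableS (path_integrable P) => //.
  by apply: subset_itvr; rewrite bnd_simp.
have : \int[mu]_(r in `[s, b]) g r = \int[mu]_(r in `[s, t]) g r
    + \int[mu]_(r in `[t, b]) g r.
  have [->|nst] := eqVneq s t; first by rewrite set_itv1 Rintegral_set1 add0r.
  have := @Rintegral_itvB _ g (BLeft s) (BRight b) t intg.
  rewrite !bnd_simp tb st => /(_ isT isT).
  rewrite -(@Rintegral_itv_obnd_cbnd _ t (BRight b)).
    by move=> <-; rewrite addrC subrK.
  apply: integrableS intg => //.
  by apply: subset_itvr; rewrite bnd_simp.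
lra.
Qed.

Context (b : R) (y1 m1 k1 v1 g1 l1 u1 y2 m2 k2 v2 g2 l2 u2 : R -> R).
Hypothesis P1 : reflected_path b y1 m1 k1 v1 g1 l1 u1.
Hypothesis P2 : reflected_path b y2 m2 k2 v2 g2 l2 u2.
Hypothesis l12 : forall t : R, 0 <= t -> t <= b -> l1 t <= l2 t.
Hypothesis u12 : forall t : R, 0 <= t -> t <= b -> u1 t <= u2 t.
Hypothesis v12 : forall s t : R, 0 <= s -> s <= t -> t <= b ->
  v2 s - v1 s <= v2 t - v1 t.
Hypothesis g12 : \forall r \ae mu, 0 <= r -> r <= b -> y2 r <= y1 r ->
  g1 r <= g2 r.

Let y t := y1 t - y2 t.
Let m t := m1 t - m2 t.

Let kp1 := jordan_pos_part k1.
Let km2 := jordan_neg_part k2.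

Lemma gap_cvg_right t : 0 <= t -> cvg (y s @[s --> t^'+]).
Proof.
move=> t0; have [c1 _] := path_regulated P1; have [c2 _] := path_regulated P2.
by apply: is_cvgB; [exact: c1|exact: c2].
Qed.

Lemma gap_cvg_left t : 0 < t -> cvg (y s @[s --> t^'-]).
Proof.
move=> t0; have [_ c1] := path_regulated P1; have [_ c2] := path_regulated P2.
by apply: is_cvgB; [exact: c1|exact: c2].
Qed.

Lemma integrable_gap s t : 0 <= s -> t <= b ->
  mu.-integrable `[s, t] (EFin \o (fun r => g2 r - g1 r)).
Proof.
move=> s0 tb.
have I1 : `[s, t] `<=` `[0, b] by apply: subset_itv; rewrite bnd_simp.
have i1 : mu.-integrable `[s, t] (EFin \o g1).
  exact: integrableS (path_integrable P1).
have i2 : mu.-integrable `[s, t] (EFin \o g2).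
  exact: integrableS (path_integrable P2).
by apply: eq_integrable (integrableB _ i2 i1).
Qed.

(** The increments of v2 - v1, of the negative part of k1 and of the positive part
of k2 can only raise the drift y - m; these contributions are dropped. *)
Lemma drift_increment s t : 0 <= s -> s <= t -> t <= b ->
  \int[mu]_(r in `[s, t]) (g2 r - g1 r) - (kp1 t - kp1 s) - (km2 t - km2 s)
  <= (y t - m t) - (y s - m s).
Proof.
move=> s0 st tb; have t0 := le_trans s0 st; have sb := le_trans st tb.
have := path_increment P1 s0 st tb; have := path_increment P2 s0 st tb.
have I1 : `[s, t] `<=` `[0, b] by apply: subset_itv; rewrite bnd_simp.
rewrite RintegralB//; last 2 first.
  exact: integrableS (path_integrable P2).
  exact: integrableS (path_integrable P1).
have := v12 s0 st tb.
rewrite (jordanE (path_reflection P1) s0) (jordanE (path_reflection P1) t0).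
rewrite (jordanE (path_reflection P2) s0) (jordanE (path_reflection P2) t0).
have := jordan_neg_part_nondecreasing (path_reflection P1) s0 st.
have := jordan_pos_part_nondecreasing (path_reflection P2) s0 st.
rewrite /kp1 /km2 /y /m.
lra.
Qed.

Lemma lower_push_acts_only : acts_only kp1
  (fun r => (llim y1 r)%:E - left_limsup l1 r)%E (fun r => y1 r - l1 r) b.
Proof.
by have [] := minimality_acts_only (path_regulated P1) (path_reflection P1)
  (path_barriers P1) (path_minimality P1).
Qed.

Lemma upper_push_acts_only : acts_only km2
  (fun r => left_liminf u2 r - (llim y2 r)%:E)%E (fun r => u2 r - y2 r) b.
Proof.
by have [] := minimality_acts_only (path_regulated P2) (path_reflection P2)
  (path_barriers P2) (path_minimality P2).
Qed.

Lemma below_upper_path t : 0 <= t -> t <= b -> y1 t <= u2 t.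
Proof.
move=> t0 tb; have /andP[_ h1] := path_barriers P1 t0 tb.
exact: le_trans h1 (u12 t0 tb).
Qed.

Lemma above_lower_path t : 0 <= t -> t <= b -> l1 t <= y2 t.
Proof.
move=> t0 tb; have /andP[h1 _] := path_barriers P2 t0 tb.
exact: le_trans (l12 t0 tb) h1.
Qed.

(** While y1 > y2 nothing lowers the drift: l1 <= l2 <= y2 < y1 keeps y1 away from
its lower barrier, the only place where the positive part of k1 grows;
y2 < y1 <= u1 <= u2 keeps y2 away from its upper barrier, the only place where
the negative part of k2 grows; and the generators are ordered. *)
Lemma drift_nondecreasing_above (eta s t : R) : 0 < eta ->
  0 <= s -> s <= t -> t <= b ->
  (forall r, s <= r -> r < t -> eta <= y r) -> y s - m s <= y t - m t.
Proof.
move=> eta0 s0 st tb etay; have t0 := le_trans s0 st.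
have kp1E : kp1 s = kp1 t.
  apply: (acts_only_constant lower_push_acts_only s0 st tb eta0) => r sr rt.
    apply: (@llim_sub_left_limsup_ge _ _ _ _ s) => //.
      by have [_] := path_regulated P1; apply; exact: le_lt_trans sr.
    move=> x sx xr; have := etay x (ltW sx) (lt_le_trans xr rt).
    by have := @above_lower_path x ltac:(lra) ltac:(lra); rewrite /y; lra.
  have := etay r sr rt; have := @above_lower_path r ltac:(lra) ltac:(lra).
  by move=> h1 h2; rewrite gt_eqF//; move: h2; rewrite /y; lra.
have km2E : km2 s = km2 t.
  apply: (acts_only_constant upper_push_acts_only s0 st tb eta0) => r sr rt.
    apply: (@left_liminf_sub_llim_ge _ _ _ _ s) => //.
      by have [_] := path_regulated P2; apply; exact: le_lt_trans sr.
    move=> x sx xr; have := etay x (ltW sx) (lt_le_trans xr rt).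
    by have := @below_upper_path x ltac:(lra) ltac:(lra); rewrite /y; lra.
  have := etay r sr rt; have := @below_upper_path r ltac:(lra) ltac:(lra).
  by move=> h1 h2; rewrite gt_eqF//; move: h2; rewrite /y; lra.
have := drift_increment s0 st tb; rewrite kp1E km2E !subrr !subr0.
move=> h; rewrite -subr_ge0; apply: le_trans h.
have ig : mu.-integrable `[s, t[ (EFin \o (fun r => g2 r - g1 r)).
  apply: integrableS (integrable_gap s0 tb) => //.
  by apply: subset_itvl; rewrite bnd_simp.
rewrite -Rintegral_itv_bndo_bndc//.
rewrite /Rintegral fine_ge0// integralE.
rewrite [X in (_ - X)%E](_ : _ = 0%E) ?sube0 ?integral_ge0//.
rewrite (ae_eq_integral (cst 0%E))// ?integral0//.
  apply: measurable_realfun.measurable_funeneg.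
  exact: (measurable_int mu ig).
move: g12; apply: filterS; first exact: (ae_filter_ringOfSetsType mu).
move=> r g12r; rewrite /= in_itv/= => /andP[sr rt].
have := etay r sr rt; rewrite /y => yr.
rewrite funenegE; apply/max_idPr; rewrite -EFinN lee_fin oppr_le0 subr_ge0.
by apply: g12r; lra.
Qed.

(** The right jumps of y come from v1, v2, k1 and k2 alone; where y > 0, the
barriers forbid those that would lower y, as in [drift_nondecreasing_above],
but now using the distances to the barriers at the single time r. *)
Lemma right_jump_ge (r e : R) : 0 <= r -> r < b -> 0 < y r -> 0 < e ->
  \forall s \near r^'+, y r - e <= y s.
Proof.
move=> r0 rb yr0 e0; have e50 : 0 < e / 5 by lra.
(* One fifth of e for each of kp1, km2, m1, m2 and the integral. *)
have c1 : kp1 s @[s --> r^'+] --> kp1 r.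
  apply: (acts_only_cvg_right lower_push_acts_only) => //.
  have := @above_lower_path r r0 (ltW rb).
  by move=> h1; rewrite gt_eqF//; move: yr0; rewrite /y; lra.
have c2 : km2 s @[s --> r^'+] --> km2 r.
  apply: (acts_only_cvg_right upper_push_acts_only) => //.
  have := @below_upper_path r r0 (ltW rb).
  by move=> h1; rewrite gt_eqF//; move: yr0; rewrite /y; lra.
have c3 := path_noise P1 r0.
have c4 := path_noise P2 r0.
have c5 := cvg_at_right_filter
  (parameterized_integral_cvg_left rb (integrable_gap r0 (lexx b))).
near=> s.
have rs : r < s by near: s; exact: nbhs_right_gt.
have sb : s <= b by near: s; exact: nbhs_right_le.
have : `|kp1 r - kp1 s| < e / 5 by near: s; move/cvgrPdist_lt : c1; exact.
have : `|km2 r - km2 s| < e / 5 by near: s; move/cvgrPdist_lt : c2; exact.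
have : `|m1 r - m1 s| < e / 5 by near: s; move/cvgrPdist_lt : c3; exact.
have : `|m2 r - m2 s| < e / 5 by near: s; move/cvgrPdist_lt : c4; exact.
have : `|0 - parameterized_integral mu r s (fun r => g2 r - g1 r)| < e / 5.
  by near: s; move/cvgrPdist_lt : c5; exact.
have := drift_increment r0 (ltW rs) sb.
rewrite !ltr_norml /parameterized_integral /m.
move=> h /andP[? ?] /andP[? ?] /andP[? ?] /andP[? ?] /andP[? ?]; lra.
Unshelve. all: by end_near. Qed.

(** If y r exceeded eps, then y would stay above eps to the right of r by
[right_jump_ge]. *)
Lemma le_of_rational_hits (r eps : R) : 0 <= r -> r < b -> 0 <= eps ->
  (forall x, r < x -> exists q : rat,
     [/\ r <= ratr q, ratr q < x & y (ratr q) < eps]) -> y r <= eps.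
Proof.
move=> r0 rb eps0 hit; rewrite leNgt; apply/negP => epsy.
have yr0 : 0 < y r by lra.
have [|d /= d0 dy] := @right_jump_ge r (y r - eps) r0 rb yr0; first by lra.
have [|q [rq qd yq]] := hit (r + d); first by lra.
have [qr|qr] := eqVneq (ratr q) r; first by move: yq; rewrite qr; lra.
have rq' : r < ratr q by rewrite lt_neqAle eq_sym qr.
have := dy (ratr q) ltac:(by rewrite /= ltr0_norm; lra) rq'.
lra.
Qed.

(** The lower bound on y at rational times bounds the one-sided limits of y, not
its values, so [drift_nondecreasing_above] applies only locally; the local
statements are joined by taking the supremum sg of the times up to which the
drift stays above its initial value. *)
Lemma drift_nondecreasing_until (eps t c : R) : 0 < eps -> 0 <= t -> t <= c ->
  c <= b -> (forall q : rat, t < ratr q -> ratr q < c -> eps <= y (ratr q)) ->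
  y t - m t <= y c - m c.
Proof.
move=> eps0 t0 tc cb yq.
pose S := [set s | t <= s <= c /\
  forall s', t <= s' -> s' <= s -> y t - m t <= y s' - m s'].
have St : S t.
  split; first by rewrite lexx.
  by move=> s' ts' s't; have -> : s' = t by lra.
have Sub : has_ubound S by exists c => s [/andP[]].
have supS : has_sup S by split; [exists t|].
set sg := sup S.
have tsg : t <= sg by exact: ub_le_sup.
have sgc : sg <= c by apply: ge_sup; [exists t|move=> s [/andP[]]].
have below s' : t <= s' -> s' < sg -> y t - m t <= y s' - m s'.
  move=> ts' s'sg.
  have [|s [_ Ss] s's] := @sup_adherent _ S (sg - s') _ supS.
    by rewrite subr_gt0.
  by apply: Ss => //; rewrite -/sg in s's; lra.
have eps2 : 0 < eps / 2 by lra.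
have eps4 : 0 < eps / 4 by lra.
have Ssg : S sg.
  split; first by rewrite tsg.
  move=> s' ts'; rewrite le_eqVlt => /predU1P[->|]; last exact: below.
  move: tsg; rewrite le_eqVlt => /predU1P[<-//|tsg].
  have [|d /= d0 dy] := @near_left_ge_rational _ y sg t eps _ tsg eps2
    (@gap_cvg_left _ (le_lt_trans t0 tsg)).
    by move=> q tq qs; apply: yq => //; lra.
  pose x := Num.max t (sg - d / 2).
  have xsg : x < sg by rewrite /x gt_max tsg/= ltrBlDr ltrDl; lra.
  have tx : t <= x by rewrite /x le_max lexx.
  have dx : sg - d / 2 <= x by rewrite /x le_max lexx orbT.
  apply: le_trans (below x tx xsg) _.
  apply: (@drift_nondecreasing_above (eps / 2)) => //; [lra|lra|lra|].
  move=> r xr rsg; have := dy r ltac:(by rewrite /= gtr0_norm; lra) rsg.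
  by lra.
have [_ Ssg'] := Ssg.
move: sgc; rewrite le_eqVlt => /predU1P[<-|sgc]; first exact: Ssg'.
exfalso.
have sg0 : 0 <= sg by lra.
have [|d /= d0 dy] := @near_right_ge_rational _ y sg c eps _ sgc eps4
    (@gap_cvg_right _ sg0).
  by move=> q tq qs; apply: yq => //; lra.
have [d' d'0 d'y] : exists2 d', 0 < d' & forall s, sg < s -> s < sg + d' ->
    s <= c -> y sg - m sg <= y s - m s.
  (* If y sg < eps / 2, the path jumps up by about eps / 2 right after sg, and
     so does the drift, because m is right-continuous. *)
  have [ysg|ysg] := leP (eps / 2) (y sg).
    exists d => // s sgs sd sc.
    apply: (@drift_nondecreasing_above (eps / 2)) => //; [lra|lra|].
    move=> r; rewrite le_eqVlt => /predU1P[<-//|sgr rs].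
    have := dy r ltac:(by rewrite /= ltr0_norm; lra) sgr.
    by lra.
  have cm : m s @[s --> sg^'+] --> m sg.
    by apply: cvgB; [exact: path_noise P1 _ sg0|exact: path_noise P2 _ sg0].
  have [d' /= d'0 d'm] := (cvgrPdist_lt _ _).1 cm _ eps4.
  exists (Num.min d d'); first by rewrite lt_min d0.
  move=> s sgs; rewrite -ltrBlDl lt_min => /andP[sd sd'] sc.
  have := dy s ltac:(by rewrite /= ltr0_norm; lra) sgs.
  have := d'm s ltac:(by rewrite /= ltr0_norm; lra) sgs.
  by rewrite ltr_norml => /andP[? ?]; lra.
pose x := Num.min c (sg + d' / 2).
have xsg : sg < x by rewrite /x lt_min sgc/= ltrDl; lra.
have xc : x <= c by rewrite /x ge_min lexx.
have dx : x <= sg + d' / 2 by rewrite /x ge_min lexx orbT.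
suff : S x by move=> /(ub_le_sup Sub); rewrite -/sg; lra.
split; first by apply/andP; split => //; lra.
move=> s' ts' s'x; have [s'sg|sgs'] := leP s' sg; first exact: Ssg'.
apply: le_trans (Ssg' _ tsg (lexx _)) _.
by apply: d'y => //; lra.
Qed.

End comparison_of_paths.

(** * Limits of integrals under uniform integrability *)

Section integrals.
Context d (T : measurableType d) (R : realType).
Variable mu : {finite_measure set T -> \bar R}.
Implicit Types (D E : set T) (f g h : T -> R).

Lemma integrable_max0 D f : measurable D -> mu.-integrable D (EFin \o f) ->
  mu.-integrable D (EFin \o (fun x => Num.max (f x) 0)).
Proof.
move=> mD intf; apply: le_integrable (intf) => //.
  apply/measurable_EFinP/measurable_maxr => //.
  exact/measurable_EFinP/(measurable_int mu).
move=> x _ /=; rewrite lee_fin; have [f0|f0] := leP (f x) 0.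
  by rewrite normr0.
by [].
Qed.

Lemma Rintegral_setID D E f : measurable D -> measurable E ->
  mu.-integrable D (EFin \o f) ->
  \int[mu]_(x in D) f x =
  \int[mu]_(x in D `&` E) f x + \int[mu]_(x in D `&` ~` E) f x.
Proof.
move=> mD mE intf; rewrite -{1}(setIT D) -(setUv E) setIUr Rintegral_setU//.
- exact: measurableI.
- by apply: measurableI => //; exact: measurableC.
- by rewrite -setIUr setUv setIT.
- apply/disj_setPS => x [[_ Ex] [_ nEx]]; exact: nEx.
Qed.

(** Vitali's theorem.  Uniform integrability is expressed by an integrable H with
a small excess of every Z n over H, which is stable under adding a fixed
integrable function; then min (Z n, H) is handled by dominated convergence. *)
Lemma uniformly_dominated_cvg0 D (Z : nat -> T -> R) : measurable D ->
  (forall n, mu.-integrable D (EFin \o Z n)) ->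
  (forall n x, D x -> 0 <= Z n x) ->
  {ae mu, forall x, D x -> Z n x @[n --> \oo] --> 0} ->
  (forall e, 0 < e -> exists H : T -> R,
     [/\ mu.-integrable D (EFin \o H), forall x, D x -> 0 <= H x &
         forall n, \int[mu]_(x in D) Num.max (Z n x - H x) 0 <= e]) ->
  forall e, 0 < e -> \forall n \near \oo, \int[mu]_(x in D) Z n x <= e.
Proof.
move=> mD intZ Z0 Zcvg UI e e0; have e20 : 0 < e / 2 by lra.
have [H [intH H0 ZH]] := UI _ e20.
pose W n x := Num.min (Z n x) (H x).
have mZ n : measurable_fun D (Z n).
  exact/measurable_EFinP/(measurable_int mu).
have mH : measurable_fun D H by exact/measurable_EFinP/(measurable_int mu).
have mW n : measurable_fun D (W n) by apply: measurable_minr.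
have W0 n x : D x -> 0 <= W n x by move=> Dx; rewrite /W le_min Z0//= H0.
have WH n x : D x -> `|W n x| <= H x.
  by move=> Dx; rewrite ger0_norm ?W0// /W ge_min lexx orbT.
have intW n : mu.-integrable D (EFin \o W n).
  apply: le_integrable (intH) => //; first exact/measurable_EFinP.
  by move=> x Dx /=; rewrite lee_fin (ger0_norm (H0 x Dx)) WH.
have [_ _ cW] : [/\ mu.-integrable D (cst 0%E),
  (\int[mu]_(x in D) `|(W n x)%:E - cst 0 x| @[n --> \oo] --> 0)%E &
  (\int[mu]_(x in D) (W n x)%:E @[n --> \oo] --> \int[mu]_(x in D) cst 0 x)%E].
  apply: (@dominated_convergence _ _ _ mu D mD (fun n x => (W n x)%:E) (cst 0%E)
    (EFin \o H)) => //.
  - by move=> n; exact/measurable_EFinP.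
  - apply: filterS Zcvg => x Zx Dx; apply: cvg_EFin; first exact: nearW.
    apply: (@squeeze_cvgr _ _ _ _ (cst 0) (Z ^~ x)) => //; last 2 first.
    + exact: cvg_cst.
    + exact: Zx.
    by apply: nearW => n /=; rewrite W0// /W ge_min lexx.
  - by apply: aeW => x n Dx /=; rewrite lee_fin WH.
move: cW; rewrite integral0 => /fine_cvgP[_ /cvgrPdist_lt /(_ _ e20)].
apply: filterS => n /=; rewrite sub0r normrN => Wn.
have -> : \int[mu]_(x in D) Z n x =
    \int[mu]_(x in D) (W n x + Num.max (Z n x - H x) 0).
  apply: eq_Rintegral => x _; rewrite /W.
  by have [zh|zh] := leP (Z n x) (H x);
    [rewrite max_r ?addr0// subr_le0|rewrite max_l ?subr_ge0 ?(ltW zh)// addrC subrK].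
rewrite RintegralD//; last first.
  apply: integrable_max0 => //.
  exact: (integrableB mD (intZ n) intH).
rewrite [leRHS]splitr lerD// ltW//.
exact: le_lt_trans (ler_norm _) Wn.
Qed.

(** A single integrable function is uniformly integrable. *)
Lemma integral_excess_cvg0 D h (e : R) : measurable D ->
  mu.-integrable D (EFin \o h) -> 0 < e ->
  exists c : R, 0 <= c /\ \int[mu]_(x in D) Num.max (h x - c) 0 <= e.
Proof.
move=> mD inth e0.
have intc n : mu.-integrable D (EFin \o (fun x => h x - n%:R)).
  have intn := finite_measure_integrable_cst mu (n%:R : R) mD.
  exact: (integrableB mD inth intn).
suff [N _ /(_ N (leqnn N)) /= hN] : \forall n \near \oo,
    \int[mu]_(x in D) Num.max (h x - n%:R) 0 <= e by exists N%:R.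
apply: (@uniformly_dominated_cvg0 D (fun n x => Num.max (h x - n%:R) 0)) => //.
- by move=> n; exact: integrable_max0.
- by move=> n x _; rewrite le_max lexx orbT.
- apply: aeW => x Dx; apply/cvgrPdist_lt => e' e'0; near=> n.
  rewrite max_r ?subrr ?normr0// subr_le0; near: n.
  exact: nbhs_infty_ger.
- move=> e' e'0; exists (fun x => `|h x|); split => //.
    exact: integrable_norm.
  move=> n; rewrite (_ : \int[mu]_(x in D) _ = 0) ?ltW//.
  transitivity (\int[mu]_(x in D) (cst 0 x : R)).
    apply: eq_Rintegral => x _; apply/max_idPr; rewrite subr_le0.
    rewrite ge_max normr_ge0 andbT (le_trans _ (ler_norm _))//.
    by rewrite lerBlDr lerDl.
  by rewrite /Rintegral integral0.
Unshelve. all: by end_near. Qed.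

End integrals.

(** * Optional stopping *)

Section conditional_expectation.
Context {R : realType} {d : measure_display} {Omega : measurableType d}.
Variable P : probability Omega R.
Implicit Types (G : set (set Omega)) (X Z : Omega -> R) (A B D E : set Omega).

Lemma sigma_algebra_setC G A : sigma_algebra setT G -> G A -> G (~` A).
Proof. by move=> [_ GC _] GA; rewrite -setTD; exact: GC. Qed.

Lemma sigma_algebra_setU G A B : sigma_algebra setT G ->
  G A -> G B -> G (A `|` B).
Proof.
move=> [G0 _ GU] GA GB; rewrite -bigcup2E; apply: GU => n.
by rewrite /bigcup2; case: n => [//|[//|n]].
Qed.

Lemma sigma_algebra_setI G A B : sigma_algebra setT G ->
  G A -> G B -> G (A `&` B).
Proof.
move=> sG GA GB; rewrite -(setCK (A `&` B)) setCI; apply: sigma_algebra_setC => //.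
by apply: sigma_algebra_setU => //; exact: sigma_algebra_setC.
Qed.

Lemma sigma_algebra_bigcap_nat G (A : nat -> set Omega) : sigma_algebra setT G ->
  (forall n, G (A n)) -> G (\bigcap_n A n).
Proof.
move=> sG GA; rewrite -(setCK (\bigcap_n A n)) setC_bigcap.
apply: sigma_algebra_setC => //; case: (sG) => _ _; apply => n.
exact: sigma_algebra_setC.
Qed.

Lemma measurable_wrt_preimage G X (A : set R) : sigma_algebra setT G ->
  measurable_wrt G X -> measurable A -> G (X @^-1` A).
Proof.
move=> sG mX mA; have := mX measurableT A mA.
by rewrite setTI -[X in _ -> X _](sigma_algebra_id sG).
Qed.

Lemma is_cond_exp_Rintegral G X Z A : is_cond_exp P G X Z -> G A ->
  \int[P]_(w in A) Z w = \int[P]_(w in A) X w.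
Proof. by move=> [_ _ ZX] GA; rewrite /Rintegral ZX. Qed.

(** Conditional Jensen inequality for z |-> (z - c)^+: on the event Z > c, which
belongs to G, the integrals of Z - c and X - c agree; elsewhere the left-hand
integrand vanishes. *)
Lemma is_cond_exp_excess G X Z A (c : R) : sigma_algebra setT G ->
  G `<=` measurable -> P.-integrable setT (EFin \o X) -> is_cond_exp P G X Z ->
  G A ->
  \int[P]_(w in A) Num.max (Z w - c) 0 <= \int[P]_(w in A) Num.max (X w - c) 0.
Proof.
move=> sG Gm intX ZX GA; have [mZ intZ _] := ZX.
pose E := [set w | c < Z w].
have GE : G E.
  have -> : E = Z @^-1` `]c, +oo[%classic.
    by apply/seteqP; split => w; rewrite /E /= in_itv/= andbT.
  exact: measurable_wrt_preimage.
have GAE : G (A `&` E) by exact: sigma_algebra_setI.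
have GAC : G (A `&` ~` E).
  by apply: sigma_algebra_setI => //; exact: sigma_algebra_setC.
have intB Y B : P.-integrable setT (EFin \o Y) -> measurable B ->
    P.-integrable B (EFin \o (fun w => Y w - c)).
  move=> intY mB.
  have intc := finite_measure_integrable_cst P c mB.
  have intY' := integrableS measurableT mB (@subsetT _ B) intY.
  exact: (integrableB mB intY' intc).
have intM Y B : P.-integrable setT (EFin \o Y) -> measurable B ->
    P.-integrable B (EFin \o (fun w => Num.max (Y w - c) 0)).
  by move=> intY mB; apply: integrable_max0 => //; exact: intB.
rewrite !(@Rintegral_setID _ _ _ P A E) ?intM//; do ?exact: Gm.
apply: lerD.
  apply: (@le_trans _ _ (\int[P]_(w in A `&` E) (X w - c))).
    rewrite RintegralB//; first last.
    - exact: (finite_measure_integrable_cst P c (Gm _ GAE)).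
    - by apply: integrableS intX => //; exact: Gm.
    - exact: Gm.
    rewrite -(is_cond_exp_Rintegral ZX)// -RintegralB//; first last.
    - exact: (finite_measure_integrable_cst P c (Gm _ GAE)).
    - by apply: integrableS intZ => //; exact: Gm.
    - exact: Gm.
    apply: le_Rintegral; [exact: Gm|exact/intM/Gm|exact/intB/Gm|].
    by move=> w [_ Ew]; rewrite max_l// subr_ge0 ltW.
  apply: le_Rintegral; [exact: Gm|exact/intB/Gm|exact/intM/Gm|].
  by move=> w _; rewrite le_max lexx.
apply: le_Rintegral; [exact: Gm|exact/intM/Gm|exact/intM/Gm|].
move=> w [_ /negP]; rewrite -leNgt => Zc.
by rewrite max_r ?subr_le0// le_max lexx orbT.
Qed.

End conditional_expectation.

Section optional_stopping.
Context {R : realType} {d : measure_display} {Omega : measurableType d}.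
Variable P : probability Omega R.
Variable F : R -> set (set Omega).
Hypothesis hF : filtration F.
Implicit Types (N : R -> Omega -> R) (theta : Omega -> R) (l : seq R).

(** The value of N at the first time of the increasing grid l that is not before
theta, or at the horizon a. *)
Definition stop_on_grid N theta a l (w : Omega) : R :=
  foldr (fun s x => if theta w <= s then N s w else x) (N a w) l.

Lemma path_rcons_le (s a : R) l : path <=%R s (rcons l a) -> s <= a.
Proof.
elim: l s => [|x l ih] s /=; first by rewrite andbT.
by move=> /andP[sx /ih]; exact: le_trans.
Qed.

(** Optional stopping on a finite grid.  The induction adds the earliest time x of
the grid and splits according to the event theta <= x of F x, on which N x may
be replaced by N a.  The bound on excesses makes the stopped values, over all
grids, as uniformly integrable as N a. *)
Lemma stop_on_grid_martingale N theta a l s : martingale P F N ->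
  (forall t, 0 <= t -> F t [set w | theta w <= t]) ->
  0 <= s -> path <=%R s (rcons l a) ->
  [/\ P.-integrable setT (EFin \o stop_on_grid N theta a l),
      forall G, F s G ->
        \int[P]_(w in G) stop_on_grid N theta a l w = \int[P]_(w in G) N a w &
      forall c G, F s G ->
        \int[P]_(w in G) Num.max (stop_on_grid N theta a l w - c) 0 <=
        \int[P]_(w in G) Num.max (N a w - c) 0].
Proof.
move=> [aN iN cN] mtheta; have [sF Fm Fle] := hF.
elim: l s => [|x l ih] s s0 /=; first by rewrite andbT => sa; split => //;
  exact/iN/(le_trans s0).
move=> /andP[sx xl]; have x0 := le_trans s0 sx; have xa := path_rcons_le xl.
have [i1 i2 i3] := ih x x0 xl.
pose E := [set w | theta w <= x].
have FE : F x E by exact: mtheta.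
have mE : measurable E by exact: (Fm x x0).
have a0 := le_trans x0 xa.
have intS : P.-integrable setT (EFin \o stop_on_grid N theta a (x :: l)).
  have mS : measurable_fun setT (stop_on_grid N theta a (x :: l)).
    rewrite /stop_on_grid /=.
    apply: measurable_fun_ifT => //=.
    - apply: (measurable_fun_bool true); rewrite setTI.
      by rewrite (_ : _ @^-1` _ = E).
    - exact/measurable_EFinP/(measurable_int P)/iN.
    - exact/measurable_EFinP/(measurable_int P).
  have intD : P.-integrable setT (EFin \o
      (fun w => `|N x w| + `|stop_on_grid N theta a l w|)).
    apply: (integrableD measurableT (integrable_norm _) (integrable_norm _)) => //.
    exact: iN.
  apply: le_integrable intD => //; first exact/measurable_EFinP.
  move=> w _ /=; rewrite lee_fin [leRHS]ger0_norm ?addr_ge0//.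
  by case: ifPn => _; rewrite ?lerDl ?lerDr.
have split_int (f : Omega -> R) G : P.-integrable setT (EFin \o f) ->
    measurable G -> \int[P]_(w in G) f w =
    \int[P]_(w in G `&` E) f w + \int[P]_(w in G `&` ~` E) f w.
  by move=> intf mG; apply: Rintegral_setID => //; by apply: integrableS intf.
have FxG G : F s G -> F x G by exact: Fle.
have FGE G : F s G -> F x (G `&` E).
  by move=> FG; apply: sigma_algebra_setI => //; [exact: sF|exact: FxG].
have FGC G : F s G -> F x (G `&` ~` E).
  move=> FG; apply: sigma_algebra_setI; [exact: sF|exact: FxG|].
  by apply: sigma_algebra_setC => //; exact: sF.
have onE G w : w \in G `&` E -> stop_on_grid N theta a (x :: l) w = N x w.
  by rewrite inE => -[_ Ew]; rewrite /stop_on_grid /= ifT.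
have onC G w : w \in G `&` ~` E ->
    stop_on_grid N theta a (x :: l) w = stop_on_grid N theta a l w.
  by rewrite inE => -[_ /negP Ew]; rewrite /stop_on_grid /= ifN.
have mG G : F s G -> measurable G by exact: (Fm s s0).
split => //.
- move=> G FG; rewrite (split_int _ _ intS (mG _ FG)).
  rewrite [RHS](split_int _ _ (iN a a0) (mG _ FG)).
  congr (_ + _).
    transitivity (\int[P]_(w in G `&` E) N x w).
      by apply: eq_Rintegral => w /onE.
    exact: is_cond_exp_Rintegral (cN x a x0 xa) (FGE _ FG).
  transitivity (\int[P]_(w in G `&` ~` E) stop_on_grid N theta a l w).
    by apply: eq_Rintegral => w /onC.
  exact: i2 (FGC _ FG).
- move=> c G FG.
  have intc (f : Omega -> R) : P.-integrable setT (EFin \o f) ->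
      P.-integrable setT (EFin \o (fun w => Num.max (f w - c) 0)).
    move=> intf; apply: integrable_max0 => //.
    have ic := finite_measure_integrable_cst P c measurableT.
    exact: (integrableB measurableT intf ic).
  rewrite (split_int _ _ (intc _ intS) (mG _ FG)).
  rewrite [leRHS](split_int _ _ (intc _ (iN a a0)) (mG _ FG)).
  apply: lerD.
    apply: (@le_trans _ _ (\int[P]_(w in G `&` E) Num.max (N x w - c) 0)).
      by rewrite le_eqVlt; apply/predU1P; left; apply: eq_Rintegral => w /onE ->.
    apply: (is_cond_exp_excess c (sF x x0) (Fm x x0) (iN a a0) (cN x a x0 xa)).
    exact: FGE.
  apply: le_trans (i3 c _ (FGC _ FG)).
  by rewrite le_eqVlt; apply/predU1P; left; apply: eq_Rintegral => w /onC ->.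
Qed.

Definition uniform_grid (t h : R) (j n : nat) : seq R :=
  [seq t + i%:R * h | i <- iota j n].

Lemma uniform_grid_path (t h : R) j n : 0 <= h ->
  path <=%R (t + j%:R * h) (rcons (uniform_grid t h j n) (t + (j + n)%:R * h)).
Proof.
move=> h0; elim: n j => [|n ih] j; first by rewrite /= addn0 lexx.
rewrite /uniform_grid /= lexx /= -addSnnS.
apply: (path_le le_trans _ (ih j.+1)).
by rewrite lerD2l ler_wpM2r// ler_nat.
Qed.

Lemma stop_on_uniform_grid N theta (t h : R) j n w : 0 <= h ->
  t + j%:R * h <= theta w + h -> theta w <= t + (j + n)%:R * h ->
  exists r, [/\ stop_on_grid N theta (t + (j + n)%:R * h) (uniform_grid t h j n) w
    = N r w, theta w <= r & r <= theta w + h].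
Proof.
move=> h0; elim: n j => [|n ih] j jt tn.
  by exists (t + (j + 0)%:R * h); split => //; move: jt; rewrite addn0.
rewrite /stop_on_grid /=; case: ifPn => [tj|]; first by exists (t + j%:R * h).
rewrite -ltNge => jtheta.
have [||r rP] := ih j.+1.
- by rewrite -natr1 mulrDl mul1r addrA lerD2r ltW.
- by rewrite addSnnS.
- by exists r; move: rP; rewrite addSnnS.
Qed.

(** Along finer and finer grids N stopped on the grid converges to N at theta by
right-continuity, and its integral over B is that of N t.  Hence the integral
of X - Z over B is that of (stopped N) + (X - Z - N t), whose positive part
tends to 0 and is uniformly integrable.  Stating the conclusion for X and Z
avoids integrating N at theta, which is only an almost sure limit. *)
Lemma optional_stopping_le N theta (t a : R) B (X Z : Omega -> R) :
  martingale P F N ->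
  (forall s, 0 <= s -> F s [set w | theta w <= s]) ->
  0 <= t -> t <= a -> F t B ->
  P.-integrable setT (EFin \o X) -> P.-integrable setT (EFin \o Z) ->
  (\forall w \ae P, B w -> [/\ t <= theta w, theta w <= a,
     N r w @[r --> (theta w)^'+] --> N (theta w) w &
     N (theta w) w - N t w <= Z w - X w]) ->
  \int[P]_(w in B) X w <= \int[P]_(w in B) Z w.
Proof.
move=> mN mtheta t0 ta FB intX intZ hB; have [sF Fm Fle] := hF.
have [aN iN cN] := mN.
have mB : measurable B by exact: (Fm t t0).
have a0 := le_trans t0 ta.
pose h m := (a - t) / m.+1%:R.
have h0 m : 0 <= h m by rewrite divr_ge0// subr_ge0.
have aE m : a = t + (0 + m.+1)%:R * h m.
  by rewrite /h add0n mulrCA divff ?mulr1 ?pnatr_eq0// addrC subrK.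
pose S m := stop_on_grid N theta a (uniform_grid t (h m) 0 m.+1).
have Spath m : path <=%R t (rcons (uniform_grid t (h m) 0 m.+1) a).
  by have := uniform_grid_path t 0 m.+1 (h0 m); rewrite -aE mul0r addr0.
have SP m := stop_on_grid_martingale mN mtheta t0 (Spath m).
have intS m : P.-integrable setT (EFin \o S m) by have [] := SP m.
pose W w := X w - Z w - N t w.
have intW : P.-integrable setT (EFin \o W).
  exact: (integrableB measurableT (integrableB measurableT intX intZ) (iN t t0)).
pose Q m w := Num.max (S m w + W w) 0.
have onB (f : Omega -> R) : P.-integrable setT (EFin \o f) ->
    P.-integrable B (EFin \o f) by move=> intf; exact: integrableS intf.
have intSW m : P.-integrable B (EFin \o (fun w => S m w + W w)).
  exact: (integrableD mB (onB _ (intS m)) (onB _ intW)).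
have intQ m : P.-integrable B (EFin \o Q m) by exact: integrable_max0.
have XZ m :
    \int[P]_(w in B) X w - \int[P]_(w in B) Z w <= \int[P]_(w in B) Q m w.
  have -> : \int[P]_(w in B) X w - \int[P]_(w in B) Z w =
      \int[P]_(w in B) (S m w + W w).
    rewrite RintegralD ?onB// [in RHS]/W RintegralB ?onB//; last first.
    - exact: iN.
    - exact: (integrableB measurableT intX intZ).
    rewrite RintegralB ?onB//; have [_ -> // _] := SP m.
    by rewrite (is_cond_exp_Rintegral (cN t a t0 ta) FB) [RHS]addrC subrK.
  by apply: le_Rintegral => // w _; rewrite /Q le_max lexx.
rewrite -subr_le0; apply/ler_addgt0Pl => e e0; rewrite addr0.
suff [m _ /(_ m (leqnn m)) /= Qm] : \forall m \near \oo,
  \int[P]_(w in B) Q m w <= e by exact: le_trans (XZ m) Qm.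
apply: (@uniformly_dominated_cvg0 _ _ _ P B Q mB) => //.
- by move=> m w _; rewrite /Q le_max lexx orbT.
- apply: filterS hB => w hBw Bw; have [tth tha Nc NW] := hBw Bw.
  apply/cvgrPdist_lt => e' e'0.
  have [dl /= dl0 Ndl] := (cvgrPdist_lt _ _).1 Nc _ e'0.
  have [m _ mP] : \forall m \near \oo, h m < dl.
    near=> m; rewrite /h ltr_pdivrMr// -ltr_pdivrMl// mulrC.
    apply: lt_trans (_ : m%:R < _); last by rewrite ltr_nat.
    near: m; exact: nbhs_infty_gtr.
  exists m => // k /= mk; have hk := mP _ mk; rewrite /= in hk.
  have [||r [Sr thr rth]] := @stop_on_uniform_grid N theta t (h k) 0 k.+1 w (h0 k).
  + by rewrite mul0r addr0 (le_trans tth)// lerDl.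
  + by rewrite -aE.
  move: Sr; rewrite -aE -/(S k) => Sr.
  have : `|N (theta w) w - N r w| < e'.
    move: thr; rewrite le_eqVlt => /predU1P[<-|thr].
      by rewrite subrr normr0.
    by apply: Ndl => //=; rewrite ltr0_norm; lra.
  rewrite sub0r normrN /Q Sr ltr_norml => /andP[n1 n2].
  rewrite ger0_norm ?le_max ?lexx ?orbT// gt_max e'0 andbT /W.
  by lra.
- move=> e' e'0.
  have [c [c0 cP]] := integral_excess_cvg0 mB (onB _ (iN a a0)) e'0.
  exists (fun w => c + `|W w|); split.
  + have ic := finite_measure_integrable_cst P c mB.
    exact: (integrableD mB ic (integrable_norm (onB _ intW))).
  + by move=> w _; rewrite addr_ge0.
  move=> m; apply: le_trans cP.
  have [_ _ /(_ c B FB)] := SP m; apply: le_trans.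
  apply: le_Rintegral => //.
  + apply: integrable_max0 => //.
    have ic := finite_measure_integrable_cst P c mB.
    exact: (integrableB mB (intQ m) (integrableD mB ic (integrable_norm (onB _ intW)))).
  + apply: integrable_max0 => //.
    have ic := finite_measure_integrable_cst P c mB.
    exact: (integrableB mB (onB _ (intS m)) ic).
  move=> w _; rewrite -/(S m w) /Q.
  have q1 : S m w - c <= Num.max (S m w - c) 0 by rewrite le_max lexx.
  have q2 : 0 <= Num.max (S m w - c) 0 by rewrite le_max lexx orbT.
  rewrite ge_max q2 andbT.
  have := ler_norm (W w); have := normr_ge0 (W w).
  by have [] := leP (S m w + W w) 0; lra.
Unshelve. all: by end_near. Qed.

End optional_stopping.

(** * Almost sure properties, class (D) and stopping times *)

Section negligible_sections.
Context {R : realType} {d : measure_display} {Omega : measurableType d}.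
Variable P : probability Omega R.

(** Integrating the sections in the other order gives the same product measure, so
almost every section of a null set at a fixed w is null. *)
Lemma ae_product_sections (Q : R * Omega -> Prop) :
  (\forall z \ae (@lebesgue_measure R \x P)%E, Q z) ->
  \forall w \ae P, \forall t \ae (@lebesgue_measure R), Q (t, w).
Proof.
move=> [N [mN N0 QN]].
have : (@lebesgue_measure R \x^ P)%E N = 0%E.
  rewrite -N0; apply/esym; apply: product_measure_unique => // A B mA mB.
  exact: product_measure2E.
move=> intN.
have mys := @measurable_fun_ysection _ _ _ _ R (@lebesgue_measure R) N mN.
have : \forall w \ae P, lebesgue_measure (ysection N w) = 0%E.
  have := (@ae_eq_integral_abs _ _ _ P setT measurableT
    (fun w => lebesgue_measure (ysection N w)) mys).1.
  case; first by rewrite -[RHS]intN; apply: eq_integral => w _; rewrite gee0_abs.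
  move=> M [mM M0 MN]; exists M; split => //; apply: subset_trans MN.
  by move=> w /= nw h; apply: nw; exact: h.
apply: filterS => w Nw; exists (ysection N w); split => //.
  exact: measurable_ysection.
by move=> t nQ; rewrite /ysection/= inE; apply: QN.
Qed.

Lemma ae_forall_rat (Q : rat -> Omega -> Prop) :
  (forall q, \forall w \ae P, Q q w) -> \forall w \ae P, forall q, Q q w.
Proof.
move=> hQ; have : \forall w \ae P, forall n,
    if unpickle n is Some q then Q q w else True.
  by apply: ae_foralln => n; case: unpickle => [q|]; [exact: hQ|exact: aeW].
by apply: filterS => w hw q; have := hw (pickle q); rewrite pickleK.
Qed.

End negligible_sections.

Section uniform_integrability.
Context {R : realType} {d : measure_display} {Omega : measurableType d}.
Variable P : probability Omega R.
Implicit Types (S : set (Omega -> R)) (X : Omega -> R).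

Lemma measurable_norm_gt X (c : R) : measurable_fun setT X ->
  measurable [set w | c < `|X w|].
Proof.
move=> mX; have mnX : measurable_fun setT (fun w => `|X w|).
  exact: measurableT_comp.
have := mnX measurableT _ (measurable_itv `]c, +oo[); rewrite setTI.
by congr measurable; apply/seteqP; split => w /=; rewrite in_itv/= andbT.
Qed.

Lemma uniformly_integrable_integrable S X : uniformly_integrable P S -> S X ->
  P.-integrable setT (EFin \o X).
Proof.
move=> [mS UI] SX; have mX := mS _ SX.
have [c cP] := UI 1 ltr01; have /= Xc := cP _ SX.
pose A := [set w | c < `|X w|].
have mA : measurable A.
  exact: measurable_norm_gt.
have mX' D : measurable_fun D (fun w => `|X w|%:E).
  by apply/measurable_EFinP/measurableT_comp => //; exact: measurable_funTS.
apply/integrableP; split; first exact/measurable_EFinP.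
rewrite -(setUv A) ge0_integral_setU//=; last 2 first.
- exact: measurableC.
- by apply/disj_setPS => w [Aw nAw]; exact: nAw.
rewrite lte_add_pinfty//; first exact: le_lt_trans Xc (ltry _).
apply: (@le_lt_trans _ _ (\int[P]_(w in ~` A) (cst `|c|%:E w))%E).
  apply: ge0_le_integral => //; first exact: measurableC.
  by move=> w /negP; rewrite -leNgt lee_fin => h; exact: le_trans h (ler_norm _).
rewrite integral_cst; last exact: measurableC.
rewrite lte_mul_pinfty// (@le_lt_trans _ _ 1%E) ?ltry//.
by apply: probability_le1; exact: measurableC.
Qed.

(** The form of uniform integrability required by [uniformly_dominated_cvg0]. *)
Lemma uniformly_integrable_excess S (e : R) : uniformly_integrable P S -> 0 < e ->
  exists c : R, 0 <= c /\
    forall X, S X -> \int[P]_w Num.max (`|X w| - c) 0 <= e.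
Proof.
move=> UI e0; have [c cP] := UI.2 _ e0.
exists (Num.max c 0); split; first by rewrite le_max lexx orbT.
move=> X SX; have intX := uniformly_integrable_integrable UI SX.
have mX := UI.1 _ SX.
pose c' := Num.max c 0.
pose A := [set w | c < `|X w|].
have mA : measurable A.
  exact: measurable_norm_gt.
have intM : P.-integrable setT (EFin \o (fun w => Num.max (`|X w| - c') 0)).
  apply: integrable_max0 => //.
  have ic := finite_measure_integrable_cst P c' measurableT.
  exact: (integrableB measurableT (integrable_norm intX) ic).
rewrite (Rintegral_setID _ mA intM)// !setTI.
have intXA : P.-integrable A (EFin \o (fun w => `|X w|)).
  exact/integrable_norm/(integrableS measurableT).
have -> : \int[P]_(w in ~` A) Num.max (`|X w| - c') 0 = 0.
  transitivity (\int[P]_(w in ~` A) (cst 0 w : R)); last first.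
    by rewrite /Rintegral integral0.
  apply: eq_Rintegral => w; rewrite inE => /negP; rewrite -leNgt => Xc.
  by rewrite /= max_r// subr_le0 /c' le_max Xc.
rewrite addr0 -lee_fin.
apply: le_trans (cP _ SX).
rewrite -[leRHS]fineK; last exact: (integrable_fin_num mA intXA).
rewrite lee_fin; apply: le_Rintegral => //.
  exact: (integrableS measurableT).
move=> w _; rewrite ge_max normr_ge0 andbT lerBlDr lerDl.
by rewrite /c' le_max lexx orbT.
Qed.

End uniform_integrability.

Section stopping_times.
Context {R : realType} {d : measure_display} {Omega : measurableType d}.
Variable P : probability Omega R.
Variable F : R -> set (set Omega).
Hypothesis hF : filtration F.
Implicit Types (tau sigma : Omega -> \bar R) (w : Omega).

Lemma stopping_time_min tau sigma : stopping_time F tau -> stopping_time F sigma ->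
  stopping_time F (fun w => Order.min (tau w) (sigma w)).
Proof.
move=> [t0 tF] [s0 sF]; split; first by move=> w; rewrite le_min t0 s0.
move=> t t0'; have [sG _ _] := hF.
have -> : [set w | (Order.min (tau w) (sigma w) <= t%:E)%E] =
    [set w | (tau w <= t%:E)%E] `|` [set w | (sigma w <= t%:E)%E].
  by apply/seteqP; split => w /=; rewrite ge_min => /orP.
by apply: sigma_algebra_setU; [exact: sG|exact: tF|exact: sF].
Qed.

Lemma stopping_time_cst (t : R) : 0 <= t -> stopping_time F (fun=> t%:E).
Proof.
move=> t0; split => [w|s s0]; first by rewrite lee_fin.
have [sG _ _] := hF; have [F0 _ _] := sG s s0.
have [ts|st] := leP t s.
  rewrite (_ : [set _ | _] = setT); last first.
    by apply/seteqP; split => w //=; rewrite lee_fin.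
  by rewrite -(setC0); apply: sigma_algebra_setC => //; exact: sG.
rewrite (_ : [set _ | _] = set0)//; apply/seteqP; split => w //=.
by rewrite lee_fin leNgt st.
Qed.

Lemma stopping_time_gt tau (t : R) : stopping_time F tau -> 0 <= t ->
  F t [set w | (t%:E < tau w)%E].
Proof.
move=> [_ tF] t0; have [sG _ _] := hF.
rewrite (_ : [set _ | _] = ~` [set w | (tau w <= t%:E)%E]).
  by apply: sigma_algebra_setC; [exact: sG|exact: tF].
by apply/seteqP; split => w /=; [rewrite ltNge => /negP|move/negP; rewrite -ltNge].
Qed.

Lemma tminE tau (a : R) w : (0 <= tau w)%E ->
  (tmin tau a w)%:E = Order.min (tau w) a%:E.
Proof.
rewrite /tmin; case: (tau w) => [r| |]//= _.
by rewrite -EFin_min.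
Qed.

Lemma stopping_time_real tau (t : R) : stopping_time F tau -> 0 <= t ->
  (forall w, (tau w < +oo)%E) -> F t [set w | fine (tau w) <= t].
Proof.
move=> [tau0 tF] t0 tauoo.
rewrite (_ : [set _ | _] = [set w | (tau w <= t%:E)%E]); first exact: tF.
by apply/seteqP; split => w /=; have := tau0 w; have := tauoo w;
  case: (tau w) => // r _ _; rewrite lee_fin.
Qed.

(** Restricting to rational times q > t makes the event that this time is < x a
countable union of events known at time x. *)
Definition rational_entrance_time (Y : R -> Omega -> R) (t eps : R) w
    : \bar R :=
  ereal_inf [set (ratr q)%:E | q in [set q | t < ratr q /\ Y (ratr q) w < eps]].

Lemma rational_entrance_time_ge Y t eps w :
  (t%:E <= rational_entrance_time Y t eps w)%E.
Proof.
by apply: le_ereal_inf_tmp => _ [q [tq _] <-]; rewrite lee_fin ltW.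
Qed.

Lemma rational_entrance_time_before Y t eps w (q : rat) : t < ratr q ->
  ((ratr q)%:E < rational_entrance_time Y t eps w)%E -> eps <= Y (ratr q) w.
Proof.
move=> tq; apply: contraTle => Yq; rewrite -leNgt.
by apply: ereal_inf_lbound; exists q.
Qed.

Lemma rational_entrance_time_lt Y t eps w x :
  (rational_entrance_time Y t eps w < x)%E ->
  exists q : rat, [/\ t < ratr q, ((ratr q)%:E < x)%E & Y (ratr q) w < eps].
Proof. by move=> /ereal_inf_lt[_ [q [tq Yq] <-] qx]; exists q. Qed.

(** Right-continuity of the filtration turns the strict inequality into a weak
one. *)
Lemma stopping_time_rational_entrance Y t eps :
  (forall s, 0 <= s -> \bigcap_(u in `]s, +oo[) F u `<=` F s) ->
  adapted F Y -> 0 <= t -> stopping_time F (rational_entrance_time Y t eps).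
Proof.
move=> Frc aY t0; have [sG Fm Fle] := hF; split.
  by move=> w; apply: le_trans (rational_entrance_time_ge Y t eps w); rewrite lee_fin.
have before x : 0 <= x -> F x [set w | (rational_entrance_time Y t eps w < x%:E)%E].
  move=> x0.
  have -> : [set w | (rational_entrance_time Y t eps w < x%:E)%E] =
      \bigcup_(q : rat)
        [set w | (t < ratr q) && (ratr q < x) && (Y (ratr q) w < eps)].
    apply/seteqP; split => w /=.
      move=> /rational_entrance_time_lt[q [tq qx Yq]]; exists q => //=.
      by move: qx; rewrite tq Yq lte_fin => ->.
    move=> [q _ /=] /andP[/andP[tq qx] Yq].
    apply: (@le_lt_trans _ _ (ratr q)%:E); last by rewrite lte_fin.
    by apply: ereal_inf_lbound; exists q.
  rewrite -(sigma_algebra_id (sG x x0)).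
  apply: (@bigcupT_measurable_rat _ (g_sigma_algebraType (F x))) => q.
  rewrite /measurable /= (sigma_algebra_id (sG x x0)).
  have [tq|_] := ltP t (ratr q); last first.
    rewrite (_ : [set _ | _] = set0); first by have [] := sG x x0.
    by apply/seteqP; split.
  have [qx|_] := ltP (ratr q) x; last first.
    rewrite (_ : [set _ | _] = set0); first by have [] := sG x x0.
    by apply/seteqP; split.
  have q0 : 0 <= ratr q :> R by apply: ltW; exact: le_lt_trans tq.
  apply: (Fle (ratr q) x) => //; first exact: ltW.
  rewrite (_ : [set _ | _] = (Y (ratr q)) @^-1` `]-oo, eps[%classic); last first.
    by apply/seteqP; split => w /=; rewrite in_itv.
  by apply: measurable_wrt_preimage; [exact: sG|exact: aY|].
move=> s s0; apply: (Frc s s0) => u; rewrite /= in_itv/= andbT => su.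
have su0 : 0 < u - s by rewrite subr_gt0.
have -> : [set w | (rational_entrance_time Y t eps w <= s%:E)%E] =
    \bigcap_n [set w | (rational_entrance_time Y t eps w
       < (s + (u - s) / n.+1%:R)%:E)%E].
  apply/seteqP; split => w /=.
    move=> h n _ /=; apply: le_lt_trans h _.
    by rewrite lte_fin ltrDl divr_gt0.
  move=> h; apply/lee_addgt0Pr => e e0.
  have [n nP] : exists n : nat, (u - s) / n.+1%:R <= e.
    exists (Num.truncn ((u - s) / e)); rewrite ler_pdivrMr// -ler_pdivrMl//.
    by rewrite mulrC ltW// truncnS_gt.
  apply: le_trans (ltW (h n I)) _.
  by rewrite -EFinD lee_fin lerD2l.
apply: sigma_algebra_bigcap_nat; first by apply: sG; lra.
move=> n; have h0 : 0 < (u - s) / n.+1%:R by rewrite divr_gt0.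
have h1 : (u - s) / n.+1%:R <= u - s.
  by rewrite ler_pdivrMr// ler_pMr// ler1n.
move: (_ / _) h0 h1 => x x0 xu.
by apply: (Fle (s + x) u); [|lra|apply: before]; rewrite addr_ge0// ltW.
Qed.

Lemma martingaleB (N1 N2 : R -> Omega -> R) : martingale P F N1 ->
  martingale P F N2 -> martingale P F (fun t w => N1 t w - N2 t w).
Proof.
move=> [a1 i1 c1] [a2 i2 c2]; have [sG Fm _] := hF.
have aN : adapted F (fun t w => N1 t w - N2 t w).
  by move=> t t0; apply: measurable_funB; [exact: a1|exact: a2].
have iN t : 0 <= t -> P.-integrable setT (EFin \o (fun w => N1 t w - N2 t w)).
  by move=> t0; exact: (integrableB measurableT (i1 t t0) (i2 t t0)).
split => // s t s0 st; split; [exact: aN|exact: iN|].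
move=> A FA; have [_ _ e1] := c1 s t s0 st; have [_ _ e2] := c2 s t s0 st.
have mA : measurable A by exact: (Fm s s0).
have t0 := le_trans s0 st.
have onA (f : Omega -> R) : P.-integrable setT (EFin \o f) ->
    P.-integrable A (EFin \o f) by move=> intf; exact: integrableS intf.
under eq_integral do rewrite EFinB.
under [RHS]eq_integral do rewrite EFinB.
rewrite (integralB_EFin mA (onA _ (i1 s s0)) (onA _ (i2 s s0))).
rewrite (integralB_EFin mA (onA _ (i1 t t0)) (onA _ (i2 t t0))).
by rewrite e1// e2.
Qed.

(** If r is the stopping level itself, the stopped path is constant after r. *)
Lemma stopped_right_continuous (m : R -> R) tau w (r : R) : 0 <= r ->
  (r%:E <= tau w)%E -> m s @[s --> r^'+] --> m r ->
  m (tmin tau s w) @[s --> r^'+] --> m (tmin tau r w).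
Proof.
move=> r0 rtau cm; have tau0 : (0 <= tau w)%E by apply: le_trans rtau; rewrite lee_fin.
have -> : tmin tau r w = r by rewrite /tmin min_r.
move: rtau; rewrite le_eqVlt => /predU1P[rE|rtau].
  apply: cvg_near_cst; near=> s; rewrite /tmin -rE min_l// lee_fin.
  by near: s; exact: nbhs_right_ge.
have rt : \forall s \near r^'+, (s%:E <= tau w)%E.
  case: (tau w) rtau => [x| |]// => [|_]; last by apply: nearW => s; rewrite leey.
  rewrite lte_fin => rx; near=> s; rewrite lee_fin; near: s.
  exact: nbhs_right_le.
apply: cvg_trans cm; apply: near_eq_cvg; apply: filterS rt => s st.
by rewrite /tmin min_r.
Unshelve. all: by end_near. Qed.

End stopping_times.

(** * The comparison theorem *)

Section comparison.
Context {R : realType} {d : measure_display} {Omega : measurableType d}.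
Variables (P : probability Omega R) (F : R -> set (set Omega)).
Variable T : Omega -> \bar R.
Hypothesis hF : filtration F.
Hypothesis hT : stopping_time F T.

Lemma ae_and (A B : Omega -> Prop) : (\forall w \ae P, A w) ->
  (\forall w \ae P, B w) -> \forall w \ae P, A w /\ B w.
Proof. by move=> hA hB; apply: filterS2 hA hB. Qed.

Lemma le_tmin (a t : R) w : (t%:E <= T w)%E -> t <= a -> t <= tmin T a w.
Proof.
move=> tT ta; have [T0 _] := hT.
by rewrite -lee_fin tminE// le_min tT lee_fin.
Qed.

Lemma lt_tmin (a t : R) w : (t%:E < T w)%E -> t < a -> t < tmin T a w.
Proof.
move=> tT ta; have [T0 _] := hT.
by rewrite -lte_fin tminE// lt_min tT lte_fin.
Qed.

Lemma tmin_le (a t : R) w : t <= tmin T a w -> (t%:E <= T w)%E.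
Proof.
by have [T0 _] := hT; rewrite -lee_fin tminE// le_min => /andP[].
Qed.

Lemma solution_path xi f V L U Y M K : drbsde_solution P F T xi f V L U Y M K ->
  \forall w \ae P, forall a : R, 0 <= a ->
    reflected_path (tmin T a w) (Y ^~ w) (M ^~ w) (K ^~ w) (V ^~ w)
      (fun r => f r w (Y r w)) (L ^~ w) (U ^~ w).
Proof.
move=> [_ regY [_ cadM _ _] [[_ fvK _] _] LY YU minY intf eqY _].
have h := ae_and regY (ae_and cadM (ae_and fvK (ae_and LY (ae_and YU
  (ae_and minY (ae_and intf eqY)))))).
move: h; apply: filterS => w [h1 [[h2 _] [h3 [h4 [h5 [h6 [h7 h8]]]]]]] a a0.
split => //.
- move=> t t0 tb; have tI : t \in `[0, tmin T a w] by rewrite in_itv/= t0.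
  by rewrite (h4 a a0 t tI) (h5 a a0 t tI).
- exact: h6.
- exact: h7.
- by move=> t t0 tb; apply: h8 => //; rewrite in_itv/= t0.
Qed.

Variables (xi1 xi2 : Omega -> R) (f1 f2 : R -> Omega -> R -> R).
Variables (V1 V2 L1 L2 U1 U2 Y1 Y2 M1 M2 K1 K2 : R -> Omega -> R).
Hypothesis husual : usual_conditions P F.
Hypothesis sol1 : drbsde_solution P F T xi1 f1 V1 L1 U1 Y1 M1 K1.
Hypothesis sol2 : drbsde_solution P F T xi2 f2 V2 L2 U2 Y2 M2 K2.
Hypothesis hmono : \forall w \ae P, \forall t \ae (@lebesgue_measure R),
  0 <= t -> (t%:E <= T w)%E ->
  forall y z : R, y <= z -> f1 t w z <= f1 t w y.
Hypothesis hxi : \forall w \ae P, xi1 w <= xi2 w.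
Hypothesis hf : \forall z \ae (@lebesgue_measure R \x P)%E,
  0 <= z.1 -> (z.1%:E <= T z.2)%E ->
  f1 z.1 z.2 (Y2 z.1 z.2) <= f2 z.1 z.2 (Y2 z.1 z.2).
Hypothesis hV : dprocess_le P T V1 V2.
Hypothesis hL : process_le P T L1 L2.
Hypothesis hU : process_le P T U1 U2.
Hypothesis hD : class_D P F T (fun t w => Num.max (Y1 t w - Y2 t w) 0).

Let Y t w := Y1 t w - Y2 t w.
Let M t w := M1 t w - M2 t w.

Lemma generator_le : \forall w \ae P, forall a : R, 0 <= a ->
  \forall r \ae (@lebesgue_measure R), 0 <= r -> r <= tmin T a w ->
    Y2 r w <= Y1 r w -> f1 r w (Y1 r w) <= f2 r w (Y2 r w).
Proof.
have hfw := ae_product_sections hf.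
apply: filterS2 hmono hfw => w mw fw a a0.
move: mw fw; apply: filterS2; first exact: (ae_filter_ringOfSetsType lebesgue_measure).
move=> r mr fr r0 ra Yr; have rT := tmin_le ra.
exact: le_trans (mr r0 rT _ _ Yr) (fr r0 rT).
Qed.

Lemma le_of_rational_hits_ae : \forall w \ae P, forall r eps : R,
  0 <= r -> (r%:E < T w)%E -> 0 <= eps ->
  (forall x : R, r < x -> exists q : rat,
     [/\ r <= ratr q, ratr q < x & Y (ratr q) w < eps]) -> Y r w <= eps.
Proof.
have s1 := solution_path sol1; have s2 := solution_path sol2.
have h := ae_and s1 (ae_and s2 (ae_and hL (ae_and hU hV))).
move: h; apply: filterS => w [p1 [p2 [lw [uw vw]]]] r eps r0 rT eps0 hit.
have a0 : 0 <= r + 1 by lra.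
have ltb : r < tmin T (r + 1) w by apply: lt_tmin => //; lra.
apply: (le_of_rational_hits (p1 _ a0) (p2 _ a0) _ _ _) => //.
- by move=> t t0 tb; apply: (lw _ a0) => //; rewrite in_itv/= t0.
- by move=> t t0 tb; apply: (uw _ a0) => //; rewrite in_itv/= t0.
- by move=> s t s0 st /tmin_le tT; apply: vw.
Qed.

Lemma drift_nondecreasing_ae : \forall w \ae P, forall t c eps : R,
  0 < eps -> 0 <= t -> t <= c -> (c%:E <= T w)%E ->
  (forall q : rat, t < ratr q -> ratr q < c -> eps <= Y (ratr q) w) ->
  Y t w - M t w <= Y c w - M c w.
Proof.
have s1 := solution_path sol1; have s2 := solution_path sol2.
have g := generator_le.
have h := ae_and s1 (ae_and s2 (ae_and g (ae_and hL (ae_and hU hV)))).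
move: h; apply: filterS => w [p1 [p2 [gw [lw [uw vw]]]]] t c eps eps0 t0 tc cT Yq.
have a0 : 0 <= c by lra.
have cb : c <= tmin T c w by exact: le_tmin.
apply: (drift_nondecreasing_until (p1 _ a0) (p2 _ a0) _ _ _
  (gw _ a0) eps0) => //.
- by move=> r r0 rb; apply: (lw _ a0) => //; rewrite in_itv/= r0.
- by move=> r r0 rb; apply: (uw _ a0) => //; rewrite in_itv/= r0.
- by move=> s r s0 sr /tmin_le rT; apply: vw.
Qed.

(** The terminal condition in a form that covers both an infinite T and a finite
one, for which T /\ a = T as soon as a >= T. *)
Lemma terminal_le : \forall w \ae P, forall eps : R, 0 < eps ->
  exists A : R, forall a : R, A <= a -> Y (tmin T a w) w <= eps.
Proof.
have t1 := sol_terminal sol1; have t2 := sol_terminal sol2.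
apply: filterS3 t1 t2 hxi => w c1 c2 x12 eps eps0.
have [A [_ AP]] := (cvgrPdist_lt _ _).1 (cvgB c1 c2) _ eps0.
exists (A + 1) => a Aa.
have : `|xi1 w - xi2 w - (Y1 (tmin T a w) w - Y2 (tmin T a w) w)| < eps.
  by apply: AP; lra.
by rewrite ltr_norml /Y => /andP[h1 h2]; lra.
Qed.


Section localized.
Variables (tau1 tau2 : nat -> Omega -> \bar R).
Hypothesis tau1S : forall n, stopping_time F (tau1 n).
Hypothesis tau2S : forall n, stopping_time F (tau2 n).
Hypothesis tau1nd : \forall w \ae P, nondecreasing_seq (tau1 ^~ w).
Hypothesis tau2nd : \forall w \ae P, nondecreasing_seq (tau2 ^~ w).
Hypothesis tau1oo : \forall w \ae P, tau1 n w @[n --> \oo] --> +oo%E.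
Hypothesis tau2oo : \forall w \ae P, tau2 n w @[n --> \oo] --> +oo%E.
Hypothesis mart1 : forall n, martingale P F (fun t w => M1 (tmin (tau1 n) t w) w).
Hypothesis mart2 : forall n, martingale P F (fun t w => M2 (tmin (tau2 n) t w) w).

Let Yp t w := Num.max (Y1 t w - Y2 t w) 0.

Variable t : R.
Hypothesis t0 : 0 <= t.

Let excess_event (n0 : nat) := [set w | 0 < Y t w] `&` ([set w | (t%:E < T w)%E]
  `&` ([set w | (t%:E < tau1 n0 w)%E] `&` [set w | (t%:E < tau2 n0 w)%E])).

Let start w := Order.min t%:E (T w).

Lemma adaptedY : adapted F Y.
Proof.
have [[aY1 _ _] _ _ _ _ _ _ _ _ _] := sol1.
have [[aY2 _ _] _ _ _ _ _ _ _ _ _] := sol2.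
by move=> s s0; apply: measurable_funB; [exact: aY1|exact: aY2].
Qed.

Lemma excess_event_F n0 : F t (excess_event n0).
Proof.
have [sG _ _] := hF; have sGt := sG t t0.
do ![apply: sigma_algebra_setI => //]; try exact: stopping_time_gt.
rewrite (_ : [set _ | _] = Y t @^-1` `]0, +oo[%classic); last first.
  by apply/seteqP; split => w /=; rewrite in_itv/= andbT.
by apply: measurable_wrt_preimage => //; exact: adaptedY.
Qed.

Lemma class_D_value sigma : stopping_time F sigma ->
  (forall w, (sigma w <= T w)%E) -> (forall w, (sigma w < +oo)%E) ->
  [set Z | exists tau, [/\ stopping_time F tau, forall w, (tau w <= T w)%E,
       \forall w \ae P, (tau w < +oo)%E & Z = value_at Yp tau]]
    (value_at Yp sigma).
Proof. by move=> sS sT soo; exists sigma; split => //; exact: aeW. Qed.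

Lemma integrable_start : P.-integrable setT (EFin \o value_at Yp start).
Proof.
apply: (uniformly_integrable_integrable hD); apply: class_D_value.
- by apply: stopping_time_min => //; exact: stopping_time_cst.
- by move=> w; rewrite /start ge_min lexx orbT.
- by move=> w; rewrite /start gt_min ltry.
Qed.

Section exit.
Variable eps : R.
Hypothesis eps0 : 0 < eps.

(* The first time after t at which Y falls below eps, and its localization: the
   latter is the time at which the martingales are stopped. *)
Let rho := rational_entrance_time Y t eps.

Let theta n w := Order.min (rho w) (Order.min (tau1 n w)
  (Order.min (tau2 n w) (Order.min (T w) n%:R%:E))).

Lemma stopping_time_theta n : stopping_time F (theta n).
Proof.
have [_ Frc] := husual.
apply: stopping_time_min => //.
  by apply: stopping_time_rational_entrance => //; exact: adaptedY.
do 3![apply: stopping_time_min => //].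
exact: stopping_time_cst.
Qed.

Lemma theta_lty n w : (theta n w < +oo)%E.
Proof. by rewrite /theta !gt_min ltry !orbT. Qed.

Lemma theta_le_T n w : (theta n w <= T w)%E.
Proof. by rewrite /theta !ge_min lexx !orbT. Qed.

Lemma theta_fine n w : (fine (theta n w))%:E = theta n w.
Proof.
by rewrite fineK// ge0_fin_numE ?theta_lty//; have [] := stopping_time_theta n.
Qed.

Lemma value_at_theta n w : value_at Yp (theta n) w = Yp (fine (theta n w)) w.
Proof. by rewrite /value_at -theta_fine. Qed.

Lemma integrable_theta n : P.-integrable setT (EFin \o value_at Yp (theta n)).
Proof.
apply: (uniformly_integrable_integrable hD); apply: class_D_value.
- exact: stopping_time_theta.
- exact: theta_le_T.
- exact: theta_lty.
Qed.

(** On the event, Y - M does not decrease between t and theta, where M = M1 - M2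
agrees with a martingale; so Y is a submartingale between these times, and its
positive part dominates it at theta. *)
Lemma stopping_inequality n0 n : (n0 <= n)%N -> t <= n%:R ->
  \int[P]_(w in excess_event n0) value_at Yp start w <=
  \int[P]_(w in excess_event n0) value_at Yp (theta n) w.
Proof.
move=> n0n tn.
have [_ _ [_ cM1 _ _] _ _ _ _ _ _ _] := sol1.
have [_ _ [_ cM2 _ _] _ _ _ _ _ _ _] := sol2.
have mN := martingaleB hF (mart1 n) (mart2 n).
apply: (optional_stopping_le hF mN _ t0 tn (excess_event_F n0)
  integrable_start (integrable_theta n)
  (theta := fun w => fine (theta n w))).
  move=> s s0; apply: stopping_time_real => //; first exact: stopping_time_theta.
  exact: theta_lty.
have h := ae_and cM1 (ae_and cM2 (ae_and tau1nd (ae_and tau2nd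
  drift_nondecreasing_ae))).
move: h; apply: filterS => w [[c1 _] [[c2 _] [nd1 [nd2 drift]]]] [Yt [tT [tt1 tt2]]].
rewrite /= in Yt tT tt1 tt2.
have tt1' : (t%:E < tau1 n w)%E by apply: lt_le_trans tt1 _; exact: nd1.
have tt2' : (t%:E < tau2 n w)%E by apply: lt_le_trans tt2 _; exact: nd2.
have th0 : 0 <= fine (theta n w).
  by rewrite -lee_fin theta_fine; have [] := stopping_time_theta n.
have tth : t <= fine (theta n w).
  rewrite -lee_fin theta_fine /theta !le_min rational_entrance_time_ge.
  by rewrite (ltW tt1') (ltW tt2') (ltW tT) lee_fin tn.
have th1 : ((fine (theta n w))%:E <= tau1 n w)%E.
  by rewrite theta_fine /theta !ge_min lexx !orbT.
have th2 : ((fine (theta n w))%:E <= tau2 n w)%E.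
  by rewrite theta_fine /theta !ge_min lexx !orbT.
split => //.
- by rewrite -lee_fin theta_fine /theta !ge_min lexx !orbT.
- apply: cvgB.
    exact: (@stopped_right_continuous _ _ _ (M1 ^~ w) (tau1 n) w _ th0 th1 (c1 _ th0)).
  exact: (@stopped_right_continuous _ _ _ (M2 ^~ w) (tau2 n) w _ th0 th2 (c2 _ th0)).
have tmin_le_tau tau s : (s%:E <= tau)%E -> fine (Order.min tau s%:E) = s.
  by move=> ?; rewrite min_r.
rewrite /tmin !tmin_le_tau// ?(ltW tt1') ?(ltW tt2')//.
rewrite value_at_theta /value_at /start min_l ?(ltW tT)//.
have := drift t (fine (theta n w)) eps eps0 t0 tth.
rewrite theta_fine => /(_ (theta_le_T n w)).
have before (q : rat) : t < ratr q -> ratr q < fine (theta n w) ->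
    eps <= Y (ratr q) w.
  move=> tq qth; apply: (rational_entrance_time_before tq).
  by move: qth; rewrite -lte_fin theta_fine /theta lt_min => /andP[].
move=> /(_ before); rewrite /Yp /M.
have -> : Num.max (Y1 t w - Y2 t w) 0 = Y t w by rewrite max_l// ltW.
have : Y (fine (theta n w)) w <= Num.max
    (Y1 (fine (theta n w)) w - Y2 (fine (theta n w)) w) 0 by rewrite le_max lexx.
lra.
Qed.

(** If rho < T, then theta n is eventually rho, where Y is at most eps by
[le_of_rational_hits_ae].  Otherwise theta n is T /\ a with a tending to infinity,
and Y tends to xi1 - xi2 <= 0 along these times. *)
Lemma exit_value_ae : \forall w \ae P, \forall n \near \oo,
  value_at Yp (theta n) w <= eps.
Proof.
have h := ae_and tau1oo (ae_and tau2oo (ae_and terminal_le le_of_rational_hits_ae)).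
move: h; apply: filterS => w [/cvgeyPgt oo1 [/cvgeyPgt oo2 [term hits]]].
suff : \forall n \near \oo, Y (fine (theta n w)) w <= eps.
  apply: filterS => n Yn; rewrite value_at_theta /Yp ge_max Yn/=.
  exact: ltW.
have T0 : (0 <= T w)%E by have [] := hT.
have [rhoT|Trho] := ltP (rho w) (T w).
  have rho0 : (0%:E <= rho w)%E.
    by apply: le_trans (rational_entrance_time_ge Y t eps w); rewrite lee_fin.
  have : rho w \is a fin_num by rewrite ge0_fin_numE// (lt_le_trans rhoT)// leey.
  move=> rhofin; pose r := fine (rho w); have rE : r%:E = rho w by rewrite fineK.
  have Yr : Y r w <= eps.
    apply: hits; [by rewrite -lee_fin rE|by rewrite rE|exact: ltW|].
    move=> x rx.
    have [|q [tq qx Yq]] := @rational_entrance_time_lt _ d Omega Y t eps w x%:E.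
      by rewrite -/rho -rE lte_fin.
    exists q; split => //; rewrite -lee_fin rE.
    by apply: ereal_inf_lbound; exists q.
  near=> n; suff -> : theta n w = rho w by [].
  rewrite /theta; apply/min_idPl; rewrite !le_min (ltW rhoT) -rE lee_fin.
  apply/and4P; split => //; apply/ltW.
  - by near: n; exact: oo1.
  - by near: n; exact: oo2.
  - by near: n; exact: nbhs_infty_gtr.
have [A AP] := term eps eps0.
pose a n := fine (Order.min (tau1 n w) (Order.min (tau2 n w) n%:R%:E)).
have aE n : (a n)%:E = Order.min (tau1 n w) (Order.min (tau2 n w) n%:R%:E).
  rewrite /a fineK// ge0_fin_numE; first by rewrite !gt_min ltry !orbT.
  by rewrite !le_min lee_fin ler0n; have [-> _] := tau1S n; have [-> _] := tau2S n.
near=> n.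
have -> : fine (theta n w) = tmin T (a n) w.
  rewrite /tmin aE /theta; congr fine.
  rewrite min_r; last by rewrite !ge_min Trho !orbT.
  by rewrite !(minCA _ (T w)).
apply: AP; rewrite -lee_fin aE !le_min; apply/and3P; split; apply/ltW.
- by near: n; exact: oo1.
- by near: n; exact: oo2.
- by rewrite lte_fin; near: n; exact: nbhs_infty_gtr.
Unshelve. all: by end_near. Qed.

(** Class (D) makes the values at theta n uniformly integrable, so the almost sure
bound of [exit_value_ae] passes to the integral; the second eps is the bound
itself, the first one the error. *)
Lemma start_value_le n0 :
  \int[P]_(w in excess_event n0) value_at Yp start w <= eps + eps.
Proof.
have [_ Fm _] := hF.
have mB : measurable (excess_event n0) by exact: (Fm t t0 _ (excess_event_F n0)).
have iB (f : Omega -> R) : P.-integrable setT (EFin \o f) ->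
  P.-integrable (excess_event n0) (EFin \o f) by move=> i; exact: integrableS i.
have ic c : P.-integrable setT (EFin \o (fun=> c)).
  exact: finite_measure_integrable_cst.
pose W n w := Num.max (value_at Yp (theta n) w - eps) 0.
have iW n : P.-integrable setT (EFin \o W n).
  apply: integrable_max0 => //.
  exact: (integrableB measurableT (integrable_theta n) (ic eps)).
have Zc n c : P.-integrable setT (EFin \o (fun w =>
    Num.max (`|value_at Yp (theta n) w| - c) 0)).
  apply: integrable_max0 => //.
  exact: (integrableB measurableT (integrable_norm (integrable_theta n)) (ic c)).
have : \forall n \near \oo, \int[P]_w W n w <= eps.
  apply: uniformly_dominated_cvg0 => //.
  - by move=> n w _; rewrite /W le_max lexx orbT.
  - have := exit_value_ae; apply: filterS => w wP _.
    apply: cvg_near_cst; apply: filterS wP => n Zn.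
    by rewrite /W max_r// subr_le0.
  - move=> e e0; have [c [c0 cP]] := uniformly_integrable_excess hD e0.
    exists (fun=> c); split => // n.
    apply: le_trans (cP _ (class_D_value (stopping_time_theta n) (theta_le_T n)
      (theta_lty n))).
    apply: le_Rintegral => //.
      apply: integrable_max0 => //.
      exact: (integrableB measurableT (iW n) (ic c)).
    move=> w _; rewrite /W.
    have key (v m : R) : `|v| - c <= m -> 0 <= m ->
        Num.max (Num.max (v - eps) 0 - c) 0 <= m.
      move=> v1 v2; rewrite ge_max v2 andbT; have [v3|v3] := leP (v - eps) 0.
        by lra.
      apply: le_trans v1; rewrite lerD2r (le_trans _ (ler_norm v))//.
      by rewrite lerBlDr lerDl ltW.
    by apply: key; rewrite le_max lexx ?orbT.
move=> [N _ NP].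
pose n := maxn (maxn N n0) (Num.truncn t).+1.
have Wn : \int[P]_w W n w <= eps.
  by apply: NP; rewrite /= /n !leq_max leqnn.
have nn0 : (n0 <= n)%N by rewrite /n !leq_max leqnn orbT.
have tn : t <= n%:R.
  apply: le_trans (ltW (truncnS_gt t)) _.
  by rewrite ler_nat /n leq_max leqnn orbT.
apply: le_trans (stopping_inequality nn0 tn) _.
apply: (@le_trans _ _ (\int[P]_(w in excess_event n0) (W n w + eps))).
  apply: le_Rintegral => //; first exact/iB/integrable_theta.
    exact: (integrableD mB (iB _ (iW n)) (iB _ (ic eps))).
  move=> w _; rewrite /W.
  have : value_at Yp (theta n) w - eps <= Num.max (value_at Yp (theta n) w - eps) 0.
    by rewrite le_max lexx.
  lra.
rewrite RintegralD ?iB//; apply: lerD.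
  apply: le_trans Wn; rewrite [leRHS](Rintegral_setID _ mB (iW n))// setTI lerDl.
  by apply: Rintegral_ge0 => w _; rewrite /W le_max lexx orbT.
rewrite Rintegral_cst// ler_piMr ?(ltW eps0)// -lee_fin fineK ?probability_le1//.
exact: fin_num_measure.
Qed.

End exit.

(** Letting eps tend to 0, the positive part of Y t integrates to 0 over the
event, on which it is positive. *)
Lemma excess_event_negligible n0 : \forall w \ae P, ~ excess_event n0 w.
Proof.
have [_ Fm _] := hF.
have mB : measurable (excess_event n0) by exact: (Fm t t0 _ (excess_event_F n0)).
have intX : P.-integrable (excess_event n0) (EFin \o value_at Yp start).
  by apply: integrableS integrable_start.
have X0 w : 0 <= value_at Yp start w.
  by rewrite /value_at; case: (start w) => // r; rewrite /Yp le_max lexx orbT.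
have int0 : \int[P]_(w in excess_event n0) value_at Yp start w = 0.
  apply/eqP; rewrite eq_le Rintegral_ge0 ?andbT//.
  apply/ler_addgt0Pl => e e0; rewrite addr0.
  have e20 : 0 < e / 2 by lra.
  by apply: le_trans (start_value_le e20 n0) _; lra.
have : (\int[P]_(w in excess_event n0) `|(value_at Yp start w)%:E| = 0)%E.
  rewrite (eq_integral (fun w => (value_at Yp start w)%:E)); last first.
    by move=> w _; rewrite gee0_abs ?lee_fin.
  by rewrite -[LHS]fineK ?(integrable_fin_num mB intX)//; congr EFin.
move/(ae_eq_integral_abs _ mB (measurable_int P intX)).1.
apply: filterS => w h Bw; have [/= Yt [/= tT _]] := Bw.
have := h Bw; rewrite /= /value_at /start min_l ?(ltW tT)// => -[].
by rewrite /Yp max_l ?(ltW Yt)// => YE; move: Yt; rewrite /Y YE ltxx.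
Qed.

End localized.

Lemma nonpositive_before_T (t : R) : 0 <= t ->
  \forall w \ae P, (t%:E < T w)%E -> Y t w <= 0.
Proof.
move=> t0.
have [_ _ [_ _ _ [tau1 [S1 nd1 oo1 m1]]] _ _ _ _ _ _ _] := sol1.
have [_ _ [_ _ _ [tau2 [S2 nd2 oo2 m2]]] _ _ _ _ _ _ _] := sol2.
have h : \forall w \ae P, forall n : nat, ~ ([set w | 0 < Y t w]
    `&` ([set w | (t%:E < T w)%E] `&` ([set w | (t%:E < tau1 n w)%E]
    `&` [set w | (t%:E < tau2 n w)%E]))) w.
  by apply: ae_foralln => n; exact: (excess_event_negligible
    S1 S2 nd1 nd2 oo1 oo2 m1 m2 t0).
apply: filterS3 h oo1 oo2 => w h /cvgeyPgt /(_ t) o1 /cvgeyPgt /(_ t) o2 tT.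
rewrite leNgt; apply/negP => Yt.
have [n _ nP] := filterI o1 o2.
by have [q1 q2] := nP n (leqnn n); apply: (h n).
Qed.

(** The previous lemma gives the inequality at rational times before T, hence at
all times before T by [le_of_rational_hits_ae]; the time T itself is covered by
the terminal condition. *)
Lemma comparison_ae : process_le P T Y1 Y2.
Proof.
have hq : \forall w \ae P, forall q : rat, 0 <= ratr q :> R ->
    ((ratr q)%:E < T w)%E -> Y (ratr q) w <= 0.
  apply: ae_forall_rat => q.
  have [q0|q0] := leP 0 (ratr q : R); last exact: aeW.
  by apply: filterS (nonpositive_before_T q0) => w + _.
apply: filterS3 hq le_of_rational_hits_ae terminal_le => w qY hits term a a0 s.
rewrite in_itv/= => /andP[s0 sa]; rewrite -subr_le0.
have sT := tmin_le sa.
apply/ler_addgt0Pl => e e0; rewrite addr0.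
move: (sT); rewrite le_eqVlt => /predU1P[sE|sltT].
  have [A AP] := term e e0; have := AP (Num.max A s).
  rewrite le_max lexx => /(_ isT).
  by rewrite /tmin -sE min_l// lee_fin le_max lexx orbT.
apply: hits => //; first exact: ltW.
move=> x sx.
have [c [sc cx cT]] : exists c : R, [/\ s < c, c <= x & (c%:E <= T w)%E].
  case: (T w) sltT => [T'| |]//; last by move=> _; exists x; rewrite leey.
  rewrite lte_fin => sT'; exists (Num.min x T').
  by rewrite lt_min sx sT' !lee_fin !ge_min !lexx orbT.
have [q] := rat_in_itvoo sc; rewrite in_itv/= => /andP[sq qc].
exists q; split; [exact: ltW|exact: lt_le_trans cx|].
apply: le_lt_trans e0; apply: qY; first by apply: le_trans s0 (ltW sq).
by apply: lt_le_trans cT; rewrite lte_fin.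
Qed.

End comparison.

Theorem proposition0p4p3 (R : realType) (d : measure_display)
  (Omega : measurableType d) (P : probability Omega R)
  (F : R -> set (set Omega)) (T : Omega -> \bar R)
  (xi1 xi2 : Omega -> R) (f1 f2 : R -> Omega -> R -> R)
  (V1 V2 L1 L2 U1 U2 : R -> Omega -> R)
  (Y1 Y2 M1 M2 K1 K2 : R -> Omega -> R)
  (hF : filtration F) (husual : usual_conditions P F)
  (hT : stopping_time F T)
  (data1 : drbsde_data P F T xi1 f1 V1 L1 U1)
  (data2 : drbsde_data P F T xi2 f2 V2 L2 U2)
  (sol1 : drbsde_solution P F T xi1 f1 V1 L1 U1 Y1 M1 K1)
  (sol2 : drbsde_solution P F T xi2 f2 V2 L2 U2 Y2 M2 K2)
  (hmono : \forall w \ae P, \forall t \ae (@lebesgue_measure R),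
     0 <= t -> (t%:E <= T w)%E ->
     forall y z : R, y <= z -> f1 t w z <= f1 t w y)
  (hxi : \forall w \ae P, xi1 w <= xi2 w)
  (hf : \forall z \ae (@lebesgue_measure R \x P)%E,
     0 <= z.1 -> (z.1%:E <= T z.2)%E ->
     f1 z.1 z.2 (Y2 z.1 z.2) <= f2 z.1 z.2 (Y2 z.1 z.2))
  (hV : dprocess_le P T V1 V2)
  (hL : process_le P T L1 L2)
  (hU : process_le P T U1 U2)
  (hD : class_D P F T (fun t w => Num.max (Y1 t w - Y2 t w) 0)) :
  process_le P T Y1 Y2.

Proof.
exact: (comparison_ae hF hT husual sol1 sol2 hmono hxi hf hV hL hU hD).
Qed.
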